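(* There exists a planar graph $G$ such that every straight-line drawing of $G$ in $\mathbb{R}^2$ whose vertices and edges are contained in the union of $\rho^1_2(G)$ lines has at least one vertex with an irrational coordinate. *)

(* Defs.v *)
From Stdlib Require Import Reals QArith Qreals List.
Open Scope R_scope.

Record graph := Graph {
  nv : nat;
  adj : nat -> nat -> Prop;
  adj_range : forall u v, adj u v -> (u < nv)%nat /\ (v < nv)%nat;
  adj_sym : forall u v, adj u v -> adj v u;
  adj_irrefl : forall u, ~ adj u u
}.

Definition point := (R * R)%type.

Definition on_seg (P Q X : point) : Prop :=
  exists t, 0 <= t <= 1 /\
    fst X = (1 - t) * fst P + t * fst Q /\
    snd X = (1 - t) * snd P + t * snd Q.

Definition line := (R * R * R)%type.
Definition is_line (l : line) : Prop :=
  let '(a, b, _) := l in ~ (a = 0 /\ b = 0).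
Definition on_line (l : line) (X : point) : Prop :=
  let '(a, b, c) := l in a * fst X + b * snd X = c.

Definition drawing (G : graph) (p : nat -> point) : Prop :=
  (forall u v, (u < nv G)%nat -> (v < nv G)%nat -> p u = p v -> u = v) /\
  (forall u v w, adj G u v -> (w < nv G)%nat -> w <> u -> w <> v ->
     ~ on_seg (p u) (p v) (p w)) /\
  (forall a b c d X, adj G a b -> adj G c d ->
     ~ ((a = c /\ b = d) \/ (a = d /\ b = c)) ->
     on_seg (p a) (p b) X -> on_seg (p c) (p d) X ->
     (X = p a \/ X = p b) /\ (X = p c \/ X = p d)).

(* Planar graph: admits a crossing-free straight-line drawing (Fary). *)
Definition planar (G : graph) : Prop := exists p, drawing G p.

Definition covered_by (G : graph) (p : nat -> point) (L : list line) : Prop :=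
  Forall is_line L /\
  (forall v, (v < nv G)%nat -> exists l, In l L /\ on_line l (p v)) /\
  (forall u v X, adj G u v -> on_seg (p u) (p v) X ->
     exists l, In l L /\ on_line l X).

Definition drawable_on_lines (G : graph) (p : nat -> point) (k : nat) : Prop :=
  drawing G p /\ exists L, length L = k /\ covered_by G p L.

Definition rho12 (G : graph) (k : nat) : Prop :=
  (exists p, drawable_on_lines G p k) /\
  (forall p m, drawable_on_lines G p m -> (k <= m)%nat).

Definition rational (x : R) : Prop := exists q : Q, Q2R q = x.

(* Main.v *)
(* The graph is cut out of the ten lines formed by the sides and the axes of symmetry of a
   regular pentagon: its vertices are all the crossing points of these lines, together with
   two leaves at each tip of the surrounding pentagram.

   At most two edges at a vertex lie on one line, so a vertex of degree [d] lies on at least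
   [d / 2] lines, while two lines share at most one vertex.  Counting pairs of lines shows
   that ten lines are necessary, and that with ten lines every two lines cross in a vertex
   and all multiplicities are those of the pentagon.  Since edges of a triangle are never
   collinear, this determines which edges are collinear: the drawing has the incidences of a
   projective pentagon with its five axes.  A cross-ratio of four of the axes is then, up to
   sign, a root of [x^2 = x + 1]. *)
Require Import Defs.
From Stdlib Require Import Reals QArith Qreals List.
From Stdlib Require Import ZArith Arith Lia Lra Nsatz Classical.
Import ListNotations.
Open Scope R_scope.

(** The leaves serve the count alone: they raise the degree of a tip from 3 to 5 and so force a
    third line there. With them the forced crossings come to exactly [10 * 9] ordered pairs of
    lines, so ten lines leave no slack anywhere. Two gaps separate the definitions from this count.
    A cover speaks of single points, so each edge must first be shown to lie in one line of the
    list; and a list may name a line twice, so repetitions must be removed. The incidences survive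
    every projective map that keeps the drawing bounded, so neither lengths nor affine ratios are
    determined and only a projective invariant can carry the irrationality. The equation for it
    comes from the tips: each is an intersection of an axis with two sides, which gives a relation
    between oriented areas seen from the centre, and the Pluecker relations close the system. The
    invariant is a rational expression in the coordinates of the centre and the five vertices, while
    [x^2 = x + 1] has discriminant 5. *)

(* For [i] modulo 5: [0] is the centre, [1 + i] a vertex of the pentagon, [6 + i] the midpoint
   of the side opposite to it, [11 + i] the tip of the pentagram beyond that midpoint, and
   [16 + i], [21 + i] are the leaves attached to the tip. *)
Definition edges : list (nat * nat) :=
  flat_map (fun i =>
    [(0, 1 + i); (0, 6 + i);
     (6 + i, 1 + (i + 2) mod 5); (6 + i, 1 + (i + 3) mod 5); (6 + i, 11 + i);
     (11 + i, 1 + (i + 2) mod 5); (11 + i, 1 + (i + 3) mod 5);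
     (11 + i, 16 + i); (11 + i, 21 + i)]%nat) (seq 0 5).

Definition adjb (u v : nat) : bool :=
  existsb (fun e => ((fst e =? u) && (snd e =? v) || (fst e =? v) && (snd e =? u))%nat)
    edges.

Lemma adjb_edge u v : adjb u v = true -> In (u, v) edges \/ In (v, u) edges.
Proof.
  unfold adjb; intros H; apply existsb_exists in H as [[a b] [Hin H]]; simpl in H.
  apply Bool.orb_true_iff in H as [H | H]; apply andb_prop in H as [H1 H2];
    apply Nat.eqb_eq in H1, H2; subst; auto.
Qed.

Lemma edges_forall (f : nat * nat -> bool) :
  forallb f edges = true -> forall u v, In (u, v) edges -> f (u, v) = true.
Proof. intros H u v Hin; rewrite forallb_forall in H; auto. Qed.

Lemma adjb_range u v : adjb u v = true -> (u < 26 /\ v < 26)%nat.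
Proof.
  assert (H := edges_forall (fun e => (fst e <? 26) && (snd e <? 26))%nat eq_refl).
  intros Huv; apply adjb_edge in Huv as [Huv | Huv]; apply H in Huv; simpl in Huv;
    apply andb_prop in Huv as [H1 H2]; apply Nat.ltb_lt in H1, H2; auto.
Qed.

Lemma adjb_sym u v : adjb u v = true -> adjb v u = true.
Proof.
  unfold adjb; rewrite !existsb_exists; intros [e [Hin He]]; exists e; split; auto.
  rewrite Bool.orb_comm; exact He.
Qed.

Lemma adjb_irrefl u : adjb u u <> true.
Proof.
  assert (H := edges_forall (fun e => negb (fst e =? snd e))%nat eq_refl).
  intros Hu; apply adjb_edge in Hu as [Hu | Hu]; apply H in Hu; simpl in Hu;
    rewrite Nat.eqb_refl in Hu; discriminate.
Qed.

Definition pentagon_graph : graph :=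
  Graph 26 (fun u v => adjb u v = true) adjb_range adjb_sym adjb_irrefl.

(** * Sums of natural numbers *)

Section Sums.
Local Open Scope nat_scope.

Definition nsum {A} (f : A -> nat) (l : list A) : nat := list_sum (map f l).

Lemma nsum_app {A} (f : A -> nat) l1 l2 : nsum f (l1 ++ l2) = nsum f l1 + nsum f l2.
Proof. unfold nsum; rewrite map_app, list_sum_app; reflexivity. Qed.

Lemma nsum_add {A} (f g : A -> nat) l : nsum (fun x => f x + g x) l = nsum f l + nsum g l.
Proof. unfold nsum; induction l; simpl; lia. Qed.

Lemma nsum_mul {A} c (f : A -> nat) l : nsum (fun x => c * f x) l = c * nsum f l.
Proof. unfold nsum; induction l; simpl; lia. Qed.

Lemma nsum_le {A} (f g : A -> nat) l :
  (forall x, In x l -> f x <= g x) -> nsum f l <= nsum g l.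
Proof.
  unfold nsum; induction l as [|a l IH]; simpl; intros H; [lia|].
  assert (f a <= g a) by auto; assert (list_sum (map f l) <= list_sum (map g l)) by auto; lia.
Qed.

Lemma nsum_ext {A} (f g : A -> nat) l :
  (forall x, In x l -> f x = g x) -> nsum f l = nsum g l.
Proof. intros H; unfold nsum; f_equal; apply map_ext_in; auto. Qed.

Lemma nsum_const {A} c (l : list A) : nsum (fun _ => c) l = length l * c.
Proof. unfold nsum; induction l; simpl; lia. Qed.

Lemma nsum_swap {A B} (f : A -> B -> nat) l1 l2 :
  nsum (fun x => nsum (f x) l2) l1 = nsum (fun y => nsum (fun x => f x y) l1) l2.
Proof.
  induction l1 as [|a l1 IH].
  - change (0 = nsum (fun _ => 0) l2); rewrite nsum_const; lia.
  - change (nsum (f a) l2 + nsum (fun x => nsum (f x) l2) l1 =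
            nsum (fun y => f a y + nsum (fun x => f x y) l1) l2).
    rewrite nsum_add, IH; reflexivity.
Qed.

(** Turns an attained count into termwise equalities; the rigidity of the ten lines rests on it. *)
Lemma nsum_le_eq {A} (f g : A -> nat) l :
  (forall x, In x l -> f x <= g x) -> nsum g l <= nsum f l ->
  forall x, In x l -> f x = g x.
Proof.
  unfold nsum; induction l as [|a l IH]; simpl; intros Hle Hsum x [].
  - subst x.
    assert (f a <= g a) by auto.
    assert (list_sum (map f l) <= list_sum (map g l)) by (apply nsum_le; auto); lia.
  - apply IH; auto. assert (f a <= g a) by auto; lia.
Qed.

Lemma nsum_b2n {A} (b : A -> bool) l : nsum (fun x => Nat.b2n (b x)) l = length (filter b l).
Proof. unfold nsum; induction l as [|a l IH]; simpl; auto; destruct (b a); simpl; lia. Qed.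

Lemma filter_ge1 {A} (b : A -> bool) x l :
  In x l -> b x = true -> 1 <= length (filter b l).
Proof.
  intros Hx Bx; assert (H := proj2 (filter_In b x l) (conj Hx Bx)).
  destruct (filter b l); simpl in *; [easy | lia].
Qed.

Lemma filter_ge2 {A} (b : A -> bool) l : NoDup l -> 2 <= length (filter b l) ->
  exists x y, x <> y /\ In x l /\ In y l /\ b x = true /\ b y = true.
Proof.
  intros Hnd; assert (Hnd' := NoDup_filter b Hnd).
  assert (Hin := fun x => proj1 (filter_In b x l)).
  destruct (filter b l) as [|x [|y t]]; simpl; try lia; intros _; exists x, y.
  inversion_clear Hnd'. simpl in *.
  destruct (Hin x), (Hin y); auto 10.
Qed.

Lemma filter_ge3 {A} (b : A -> bool) l : NoDup l -> 3 <= length (filter b l) ->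
  exists x y z, x <> y /\ x <> z /\ y <> z /\ In x l /\ In y l /\ In z l /\
    b x = true /\ b y = true /\ b z = true.
Proof.
  intros Hnd; assert (Hnd' := NoDup_filter b Hnd).
  assert (Hin := fun x => proj1 (filter_In b x l)).
  destruct (filter b l) as [|x [|y [|z t]]]; simpl; try lia; intros _; exists x, y, z.
  inversion_clear Hnd' as [|? ? H1 H2]. inversion_clear H2 as [|? ? H3 H4]. simpl in *.
  destruct (Hin x), (Hin y), (Hin z); auto 10.
Qed.

End Sums.

(** * Ten lines and their incidences *)

Lemma lt5_cases i : (i < 5 -> i = 0 \/ i = 1 \/ i = 2 \/ i = 3 \/ i = 4)%nat.
Proof. lia. Qed.

Section Incidence.
Local Open Scope nat_scope.

(** [B v i] records that vertex [v] lies on line [i]. The four hypotheses are all that the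
    combinatorial argument takes from geometry. *)
Variables (k : nat) (B : nat -> nat -> bool).
Hypothesis two_points : forall u v i j, u < 26 -> v < 26 -> i < k -> j < k -> u <> v ->
  B u i = true -> B v i = true -> B u j = true -> B v j = true -> i = j.
Hypothesis edge_line : forall u v, adjb u v = true ->
  exists i, i < k /\ B u i = true /\ B v i = true.
Hypothesis two_neighbours : forall v x y z i, x <> y -> x <> z -> y <> z ->
  adjb v x = true -> adjb v y = true -> adjb v z = true -> i < k ->
  B v i = true -> B x i = true -> B y i = true -> B z i = true -> False.
Hypothesis no_flat_triangle : forall u v w i,
  adjb u v = true -> adjb v w = true -> adjb u w = true -> i < k ->
  B u i = true -> B v i = true -> B w i = true -> False.

Definition mult (v : nat) : nat := nsum (fun i => Nat.b2n (B v i)) (seq 0 k).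
(** Crossings of line [i] at vertices: a vertex on it counts once for every other line through that
    vertex. *)
Definition weight (i : nat) : nat :=
  nsum (fun v => Nat.b2n (B v i) * (mult v - 1)) (seq 0 26).
(** Half the degree, rounded up. Leaves take the default 0, which gives the same [(m - 1) * m] as
    their true bound 1. *)
Definition expected_mult (v : nat) : nat :=
  nth v [5; 3; 3; 3; 3; 3; 2; 2; 2; 2; 2; 3; 3; 3; 3; 3] 0.

Lemma mult_ge v : v < 26 -> expected_mult v <= mult v.
Proof.
  intros Hv.
  set (N := filter (adjb v) (seq 0 26)).
  assert (HN : NoDup N) by (apply NoDup_filter, seq_NoDup).
  (* Double counting of pairs of a neighbour and a line through it and [v]: every edge supplies a
     pair, and no line takes part in more than two. *)
  assert (Hdeg : length N <= 2 * mult v).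
  { transitivity (nsum (fun u => nsum (fun i => Nat.b2n (B v i && B u i)) (seq 0 k)) N).
    - replace (length N) with (nsum (fun _ => 1) N) by (rewrite nsum_const; lia).
      apply nsum_le; intros u Hu; apply filter_In in Hu as [_ Hu].
      destruct (edge_line v u Hu) as [i [Hi [H1 H2]]].
      rewrite nsum_b2n; apply (filter_ge1 _ i); [apply in_seq; lia | now rewrite H1, H2].
    - rewrite nsum_swap; unfold mult; rewrite <- nsum_mul.
      apply nsum_le; intros i Hi; apply in_seq in Hi.
      destruct (B v i) eqn:Hvi; simpl.
      + rewrite nsum_b2n.
        destruct (le_lt_dec 3 (length (filter (fun u => B u i) N))) as [H3 | H3]; [|lia].
        apply filter_ge3 in H3 as (x & y & z & Hxy & Hxz & Hyz & Hx & Hy & Hz & Bx & By & Bz);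
          auto.
        apply filter_In in Hx as [_ Hx], Hy as [_ Hy], Hz as [_ Hz].
        exfalso; apply (two_neighbours v x y z i); auto; lia.
      + rewrite nsum_const; lia. }
  (* The [+ 1] rounds odd degrees up: [2 * expected_mult v <= 2 * mult v + 1] still gives the bound
     by parity. *)
  assert (Hv' : forallb (fun v => 2 * expected_mult v <=?
            length (filter (adjb v) (seq 0 26)) + 1) (seq 0 26) = true)
    by (vm_compute; reflexivity).
  rewrite forallb_forall in Hv'; specialize (Hv' v).
  rewrite in_seq, Nat.leb_le in Hv'; unfold N in Hdeg; lia.
Qed.

(** By [two_points], each of the other [k - 1] lines shares at most one vertex with line [i]. *)
Lemma weight_le i : i < k -> weight i <= k - 1.
Proof.
  intros Hi.
  set (others := seq 0 i ++ seq (S i) (k - S i)).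
  assert (Hseq : seq 0 k = seq 0 i ++ i :: seq (S i) (k - S i)).
  { replace k with (i + S (k - S i)) at 1 by lia. rewrite seq_app; reflexivity. }
  assert (Hothers : forall j, In j others -> j < k /\ j <> i).
  { intros j Hj; apply in_app_or in Hj as [Hj | Hj]; apply in_seq in Hj; lia. }
  transitivity (nsum (fun j => nsum (fun v => Nat.b2n (B v i && B v j)) (seq 0 26)) others).
  - rewrite <- nsum_swap with (f := fun v j => Nat.b2n (B v i && B v j)).
    apply nsum_le; intros v _.
    destruct (B v i) eqn:Hvi; simpl; [|lia].
    assert (mult v = 1 + nsum (fun j => Nat.b2n (B v j)) others); [|lia].
    unfold mult, others; rewrite Hseq, !nsum_app; unfold nsum at 2; simpl.
    rewrite Hvi; unfold nsum; simpl; lia.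
  - transitivity (nsum (fun _ => 1) others).
    + apply nsum_le; intros j Hj; apply Hothers in Hj as [Hj Hji].
      rewrite nsum_b2n.
      destruct (le_lt_dec 2 (length (filter (fun v => B v i && B v j) (seq 0 26))))
        as [H2 | H2]; [|lia].
      apply filter_ge2 in H2 as (u & v & Huv & Hu & Hv & Bu & Bv); [|apply seq_NoDup].
      apply andb_prop in Bu, Bv; apply in_seq in Hu, Hv.
      exfalso; apply Hji, eq_sym, (two_points u v); lia || tauto.
    + rewrite nsum_const; unfold others; rewrite length_app, !length_seq; lia.
Qed.

Lemma weight_total :
  nsum weight (seq 0 k) = nsum (fun v => (mult v - 1) * mult v) (seq 0 26).
Proof.
  unfold weight; rewrite nsum_swap; apply nsum_ext; intros v _.
  unfold mult at 3; rewrite <- nsum_mul; apply nsum_ext; intros; lia.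
Qed.

(** The centre gives [5 * 4], the five vertices and the five tips [3 * 2] each, the five midpoints
    [2 * 1] each. *)
Lemma expected_total :
  90 <= nsum (fun v => (mult v - 1) * mult v) (seq 0 26).
Proof.
  transitivity (nsum (fun v => (expected_mult v - 1) * expected_mult v) (seq 0 26)).
  - vm_compute; lia.
  - apply nsum_le; intros v Hv; apply in_seq in Hv.
    assert (H := mult_ge v ltac:(lia)); apply Nat.mul_le_mono; lia.
Qed.

Lemma lines_ge : 10 <= k.
Proof.
  assert (H := expected_total); rewrite <- weight_total in H.
  assert (H' : nsum weight (seq 0 k) <= nsum (fun _ => k - 1) (seq 0 k)).
  { apply nsum_le; intros i Hi; apply in_seq in Hi; apply weight_le; lia. }
  rewrite nsum_const, length_seq in H'; nia.
Qed.

(** * The equality case: exactly ten lines *)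

Hypothesis k10 : k = 10.

Lemma weight_eq i : i < 10 -> weight i = 9.
Proof.
  intros Hi.
  apply (nsum_le_eq weight (fun _ => 9) (seq 0 k)).
  - intros j Hj; apply in_seq in Hj; assert (H := weight_le j); lia.
  - rewrite weight_total, nsum_const, length_seq; assert (H := expected_total); lia.
  - apply in_seq; lia.
Qed.

(** Stated for the products because a leaf may have multiplicity 1 against the expected 0. *)
Lemma mult_tight v : v < 26 ->
  (expected_mult v - 1) * expected_mult v = (mult v - 1) * mult v.
Proof.
  intros Hv.
  apply (nsum_le_eq (fun v => (expected_mult v - 1) * expected_mult v)
           (fun v => (mult v - 1) * mult v) (seq 0 26)).
  - intros u Hu; apply in_seq in Hu.
    assert (Hu' := mult_ge u ltac:(lia)); apply Nat.mul_le_mono; lia.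
  - rewrite <- weight_total.
    transitivity (nsum (fun _ => 9) (seq 0 k)).
    + apply nsum_le; intros i Hi; apply in_seq in Hi; rewrite weight_eq; lia.
    + rewrite k10; vm_compute; lia.
  - apply in_seq; lia.
Qed.

Lemma mult_eq v : v < 16 -> mult v = expected_mult v.
Proof.
  intros Hv.
  assert (Hge := mult_ge v ltac:(lia)); assert (H := mult_tight v ltac:(lia)).
  assert (2 <= expected_mult v).
  { do 16 (destruct v as [|v]; [vm_compute; lia|]); lia. }
  nia.
Qed.

Lemma leaf_mult v : 16 <= v < 26 -> mult v <= 1.
Proof.
  intros Hv; assert (H := mult_tight v ltac:(lia)).
  unfold expected_mult in H; rewrite nth_overflow in H by (simpl; lia); nia.
Qed.

(* All weights [mult v - 1] are even except at the five midpoints, where they are [1]. *)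
Lemma midpoints_ge1 i : i < 10 -> 1 <= nsum (fun v => Nat.b2n (B v i)) (seq 6 5).
Proof.
  intros Hi; assert (H := weight_eq i Hi).
  unfold weight in H.
  change (seq 0 26) with (seq 0 16 ++ seq 16 10) in H.
  rewrite nsum_app in H.
  assert (Hleaf : nsum (fun v => Nat.b2n (B v i) * (mult v - 1)) (seq 16 10) = 0).
  { rewrite (nsum_ext _ (fun _ => 0)); [now rewrite nsum_const|].
    intros v Hv; apply in_seq in Hv; assert (H' := leaf_mult v ltac:(lia)); nia. }
  rewrite Hleaf in H.
  rewrite (nsum_ext _ (fun v => Nat.b2n (B v i) * (expected_mult v - 1))) in H.
  2:{ intros v Hv; apply in_seq in Hv; now rewrite mult_eq by lia. }
  unfold nsum, expected_mult in *; cbn [seq map list_sum fold_right nth] in *; lia.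
Qed.

(** Five midpoints on two lines each make ten incidences; ten lines with at least one each leave
    none for a second. *)
Lemma midpoints_eq1 i : i < 10 -> nsum (fun v => Nat.b2n (B v i)) (seq 6 5) = 1.
Proof.
  intros Hi; symmetry.
  apply (nsum_le_eq (fun _ => 1) (fun i => nsum (fun v => Nat.b2n (B v i)) (seq 6 5))
           (seq 0 k)).
  - intros j Hj; apply in_seq in Hj; apply midpoints_ge1; lia.
  - rewrite nsum_swap, nsum_const.
    rewrite (nsum_ext _ (fun _ => 2)).
    + rewrite k10; vm_compute; lia.
    + intros v Hv; apply in_seq in Hv; change (mult v = 2).
      rewrite mult_eq by lia.
      do 6 (destruct v as [|v]; [lia|]); do 5 (destruct v as [|v]; [reflexivity|]); lia.
  - apply in_seq; lia.
Qed.

Lemma midpoint_unique i u v : i < 10 -> 6 <= u < 11 -> 6 <= v < 11 ->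
  B u i = true -> B v i = true -> u = v.
Proof.
  intros Hi Hu Hv Bu Bv; assert (H := midpoints_eq1 i Hi).
  destruct (Nat.eq_dec u v) as [|Huv]; auto; exfalso.
  unfold nsum in H; cbn [seq map list_sum fold_right] in H.
  assert (u = 6 \/ u = 7 \/ u = 8 \/ u = 9 \/ u = 10) as Hu' by lia.
  assert (v = 6 \/ v = 7 \/ v = 8 \/ v = 9 \/ v = 10) as Hv' by lia.
  destruct Hu' as [-> | [-> | [-> | [-> | ->]]]]; destruct Hv' as [-> | [-> | [-> | [-> | ->]]]];
    try lia; rewrite ?Bu, ?Bv in H; cbn [Nat.b2n] in H; lia.
Qed.

Definition common_line (u v : nat) : nat :=
  hd 0 (filter (fun i => B u i && B v i) (seq 0 k)).

Lemma common_lineP u v : adjb u v = true ->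
  common_line u v < 10 /\ B u (common_line u v) = true /\ B v (common_line u v) = true.
Proof.
  intros H; destruct (edge_line u v H) as [i [Hi [Bu Bv]]]; unfold common_line.
  assert (Hin : In i (filter (fun i => B u i && B v i) (seq 0 k))).
  { apply filter_In; split; [apply in_seq; lia | now rewrite Bu, Bv]. }
  assert (Hall := fun x => proj1 (filter_In (fun i => B u i && B v i) x (seq 0 k))).
  destruct (filter (fun i => B u i && B v i) (seq 0 k)) as [|x t]; [easy|].
  destruct (Hall x) as [Hx Bx]; [now left|].
  apply in_seq in Hx; apply andb_prop in Bx; simpl; intuition lia.
Qed.

(** Allows elimination: once enough lines through a vertex are named, every edge at it runs in one
    of them. *)
Lemma lines_through v l : v < 16 -> NoDup l -> length l = expected_mult v ->
  (forall i, In i l -> i < 10 /\ B v i = true) ->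
  forall i, i < 10 -> B v i = true -> In i l.
Proof.
  intros Hv Hnd Hlen Hl i Hi Bi.
  assert (Hincl : incl (filter (B v) (seq 0 k)) l).
  { apply NoDup_length_incl; auto.
    - rewrite <- nsum_b2n, Hlen, <- mult_eq by auto; apply Nat.le_refl.
    - intros j Hj; apply Hl in Hj as [Hj Bj]; apply filter_In; split; auto.
      apply in_seq; lia. }
  apply Hincl, filter_In; split; auto; apply in_seq; lia.
Qed.

(** * Identification of the axes and sides *)

Definition axis (i : nat) : nat := common_line 0 (6 + i).
Definition side (i : nat) : nat := common_line (6 + i) (1 + (i + 2) mod 5).

Ltac case5 H :=
  destruct (lt5_cases _ H) as [-> | [-> | [-> | [-> | ->]]]];
  cbn [Nat.add Nat.modulo Nat.divmod fst snd Nat.sub] in *.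

Lemma axisP i : i < 5 -> axis i < 10 /\ B 0 (axis i) = true /\ B (6 + i) (axis i) = true.
Proof. intros Hi; apply common_lineP; case5 Hi; reflexivity. Qed.

Lemma sideP i : i < 5 ->
  side i < 10 /\ B (6 + i) (side i) = true /\ B (1 + (i + 2) mod 5) (side i) = true.
Proof. intros Hi; apply common_lineP; case5 Hi; reflexivity. Qed.

Lemma axis_inj i j : i < 5 -> j < 5 -> axis i = axis j -> i = j.
Proof.
  intros Hi Hj E; destruct (axisP i Hi) as [? [_ H1]], (axisP j Hj) as [_ [_ H2]].
  rewrite <- E in H2; assert (6 + i = 6 + j); [|lia].
  apply (midpoint_unique (axis i)); lia || assumption.
Qed.

Lemma side_inj i j : i < 5 -> j < 5 -> side i = side j -> i = j.
Proof.
  intros Hi Hj E; destruct (sideP i Hi) as [? [H1 _]], (sideP j Hj) as [_ [H2 _]].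
  rewrite <- E in H2; assert (6 + i = 6 + j); [|lia].
  apply (midpoint_unique (side i)); lia || assumption.
Qed.

(** The centre, the midpoint and this end of the opposite side form a triangle of the graph. *)
Lemma axis_far_vertex2 i : i < 5 -> B (1 + (i + 2) mod 5) (axis i) <> true.
Proof.
  intros Hi H; destruct (axisP i Hi) as [? [H0 HM]].
  apply (no_flat_triangle 0 (6 + i) (1 + (i + 2) mod 5) (axis i));
    try assumption; try lia; case5 Hi; reflexivity.
Qed.

Lemma axis_far_vertex3 i : i < 5 -> B (1 + (i + 3) mod 5) (axis i) <> true.
Proof.
  intros Hi H; destruct (axisP i Hi) as [? [H0 HM]].
  apply (no_flat_triangle 0 (6 + i) (1 + (i + 3) mod 5) (axis i));
    try assumption; try lia; case5 Hi; reflexivity.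
Qed.

Lemma axis_neq_side i j : i < 5 -> j < 5 -> axis i <> side j.
Proof.
  intros Hi Hj E; destruct (axisP i Hi) as [? [_ H1]], (sideP j Hj) as [_ [H2 H3]].
  rewrite <- E in H2, H3; assert (i = j).
  { assert (6 + i = 6 + j); [|lia].
    apply (midpoint_unique (axis i)); lia || assumption. }
  subst j; apply (axis_far_vertex2 i Hi H3).
Qed.

Lemma side_not_centre i : i < 5 -> B 0 (side i) <> true.
Proof.
  intros Hi H0; destruct (axisP i Hi) as [? [H1 H2]], (sideP i Hi) as [? [H3 _]].
  apply (axis_neq_side i i Hi Hi), (two_points 0 (6 + i)); lia || assumption.
Qed.

Lemma midpoint_lines i l : i < 5 -> l < 10 -> B (6 + i) l = true -> l = axis i \/ l = side i.
Proof.
  intros Hi Hl H; destruct (axisP i Hi) as [? [_ H1]], (sideP i Hi) as [? [H2 _]].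
  assert (Hin : In l [axis i; side i]).
  { apply (lines_through (6 + i)); auto; [lia | | case5 Hi; reflexivity |].
    - assert (Hne := axis_neq_side i i Hi Hi).
      repeat constructor; cbn [In]; intuition congruence.
    - intros j [<- | [<- | []]]; auto. }
  destruct Hin as [<- | [<- | []]]; auto.
Qed.

(** Only two lines pass through the midpoint and the axis is excluded, so both halves of a side are
    collinear. *)
Lemma side_vertex3 i : i < 5 -> B (1 + (i + 3) mod 5) (side i) = true.
Proof.
  intros Hi.
  destruct (edge_line (6 + i) (1 + (i + 3) mod 5)) as [l [Hl [H1 H2]]];
    [case5 Hi; reflexivity|].
  destruct (midpoint_lines i l) as [-> | ->]; auto; [lia|].
  now apply axis_far_vertex3 in H2.
Qed.

(** The side already carries two neighbours of the midpoint, so the edge to the tip must take the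
    other line. *)
Lemma axis_tip i : i < 5 -> B (11 + i) (axis i) = true.
Proof.
  intros Hi.
  destruct (edge_line (6 + i) (11 + i)) as [l [Hl [H1 H2]]]; [case5 Hi; reflexivity|].
  destruct (midpoint_lines i l) as [-> | ->]; auto; [lia|].
  exfalso; destruct (sideP i Hi) as [_ [HM HP]]; assert (HP' := side_vertex3 i Hi).
  apply (two_neighbours (6 + i) (11 + i) (1 + (i + 2) mod 5) (1 + (i + 3) mod 5) (side i));
    try assumption; case5 Hi; reflexivity || discriminate.
Qed.

(** The third line is described only by passing through the centre; which axis it is follows later,
    in [axis_vertex]. *)
Lemma vertex_lines i l : i < 5 -> l < 10 -> B (1 + i) l = true ->
  B 0 l = true \/ l = side ((i + 2) mod 5) \/ l = side ((i + 3) mod 5).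
Proof.
  intros Hi Hl H.
  assert (H2 := Nat.mod_upper_bound (i + 2) 5 ltac:(lia)).
  assert (H3 := Nat.mod_upper_bound (i + 3) 5 ltac:(lia)).
  destruct (common_lineP 0 (1 + i)) as [Hc [Hc0 Hci]]; [case5 Hi; reflexivity|].
  assert (Hin : In l [common_line 0 (1 + i); side ((i + 2) mod 5); side ((i + 3) mod 5)]).
  { apply (lines_through (1 + i)); auto; [lia | | case5 Hi; reflexivity |].
    - assert (side ((i + 2) mod 5) <> side ((i + 3) mod 5)).
      { intros E; apply side_inj in E; auto; case5 Hi; discriminate. }
      assert (common_line 0 (1 + i) <> side ((i + 2) mod 5)).
      { intros E; rewrite E in Hc0; now apply side_not_centre in Hc0. }
      assert (common_line 0 (1 + i) <> side ((i + 3) mod 5)).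
      { intros E; rewrite E in Hc0; now apply side_not_centre in Hc0. }
      apply NoDup_cons; [cbn [In]; intuition congruence|].
      apply NoDup_cons; [cbn [In]; intuition congruence|].
      apply NoDup_cons; [easy | apply NoDup_nil].
    - destruct (sideP _ H2) as [Hs2 _], (sideP _ H3) as [Hs3 [_ HP2]].
      assert (HP3 := side_vertex3 _ H2).
      intros j [<- | [<- | [<- | []]]]; split; auto; case5 Hi; assumption. }
  destruct Hin as [<- | [<- | [<- | []]]]; auto.
Qed.

Lemma axis_of_centre_tip i l : i < 5 -> l < 10 -> B 0 l = true -> B (11 + i) l = true ->
  l = axis i.
Proof.
  intros Hi Hl H1 H2; destruct (axisP i Hi) as [? [H3 _]]; assert (H4 := axis_tip i Hi).
  apply (two_points 0 (11 + i)); lia || assumption.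
Qed.

Lemma side_no_own_tip i v : i < 5 -> adjb (6 + i) v = true -> adjb (11 + i) v = true ->
  B v (side i) = true -> B (11 + i) (side i) <> true.
Proof.
  intros Hi HM HS Bv BS; destruct (sideP i Hi) as [? [BM _]].
  apply (no_flat_triangle (11 + i) (6 + i) v (side i)); try assumption; try lia.
  case5 Hi; reflexivity.
Qed.

(** The edge from this tip to vertex [i + 3] has three candidate lines. The axis of the tip and the
    side of index [i + 1] would each flatten a triangle, which leaves [side i]. *)
Lemma side_tip1 i : i < 5 -> B (11 + (i + 1) mod 5) (side i) = true.
Proof.
  intros Hi.
  assert (H1 := Nat.mod_upper_bound (i + 1) 5 ltac:(lia)).
  assert (H3 := Nat.mod_upper_bound (i + 3) 5 ltac:(lia)).
  destruct (edge_line (11 + (i + 1) mod 5) (1 + (i + 3) mod 5)) as [l [Hl [HS HP]]];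
    [case5 Hi; reflexivity|].
  destruct (vertex_lines _ l H3 ltac:(lia) HP) as [H0 | [-> | ->]].
  - exfalso; rewrite (axis_of_centre_tip _ l H1 ltac:(lia) H0 HS) in HP.
    apply (axis_far_vertex2 _ H1); case5 Hi; assumption.
  - case5 Hi; assumption.
  - exfalso; apply (side_no_own_tip _ (1 + (i + 3) mod 5) H1); case5 Hi;
      assumption || reflexivity.
Qed.

Lemma side_tip4 i : i < 5 -> B (11 + (i + 4) mod 5) (side i) = true.
Proof.
  intros Hi.
  assert (H2 := Nat.mod_upper_bound (i + 2) 5 ltac:(lia)).
  assert (H4 := Nat.mod_upper_bound (i + 4) 5 ltac:(lia)).
  destruct (edge_line (11 + (i + 4) mod 5) (1 + (i + 2) mod 5)) as [l [Hl [HS HP]]];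
    [case5 Hi; reflexivity|].
  destruct (vertex_lines _ l H2 ltac:(lia) HP) as [H0 | [-> | ->]].
  - exfalso; rewrite (axis_of_centre_tip _ l H4 ltac:(lia) H0 HS) in HP.
    apply (axis_far_vertex3 _ H4); case5 Hi; assumption.
  - exfalso; apply (side_no_own_tip _ (1 + (i + 2) mod 5) H4); case5 Hi;
      assumption || reflexivity.
  - case5 Hi; assumption.
Qed.

Lemma centre_lines l : l < 10 -> B 0 l = true -> exists i, i < 5 /\ l = axis i.
Proof.
  intros Hl H.
  assert (Hin : In l (map axis (seq 0 5))).
  { apply (lines_through 0); auto; [lia | |].
    - apply NoDup_map_NoDup_ForallPairs; [|apply seq_NoDup].
      intros i j Hi Hj; apply in_seq in Hi, Hj; apply axis_inj; lia.
    - intros j Hj; apply in_map_iff in Hj as [i [<- Hi]]; apply in_seq in Hi.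
      destruct (axisP i) as [? [? _]]; auto; lia. }
  apply in_map_iff in Hin as [i [<- Hi]]; apply in_seq in Hi; exists i; split; [lia | easy].
Qed.

(* A neighbouring vertex on the axis would lie, with the tip, on a side line as well. *)
Lemma axis_vertex_eq i j : i < 5 -> j < 5 -> B (1 + j) (axis i) = true -> i = j.
Proof.
  intros Hi Hj H.
  assert (H1 := Nat.mod_upper_bound (i + 1) 5 ltac:(lia)).
  assert (H4 := Nat.mod_upper_bound (i + 4) 5 ltac:(lia)).
  destruct (axisP i Hi) as [Ha _]; assert (HS := axis_tip i Hi).
  assert (Hcases : i = j \/ j = (i + 1) mod 5 \/ j = (i + 2) mod 5 \/ j = (i + 3) mod 5
                   \/ j = (i + 4) mod 5) by (case5 Hi; lia).
  destruct Hcases as [E | [-> | [-> | [-> | ->]]]]; auto; exfalso.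
  - destruct (sideP _ H4) as [Hs [_ HP]]; assert (HT := side_tip1 _ H4).
    apply (axis_neq_side i _ Hi H4), (two_points (1 + (i + 1) mod 5) (11 + i));
      try assumption; try lia; case5 Hi; assumption.
  - now apply axis_far_vertex2 in H.
  - now apply axis_far_vertex3 in H.
  - destruct (sideP _ H1) as [Hs _]; assert (HP := side_vertex3 _ H1).
    assert (HT := side_tip4 _ H1).
    apply (axis_neq_side i _ Hi H1), (two_points (1 + (i + 4) mod 5) (11 + i));
      try assumption; try lia; case5 Hi; assumption.
Qed.

(** The five axes exhaust the lines through the centre, so the edge from there to the vertex lies on
    one of them, and [axis_vertex_eq] fixes its index. *)
Lemma axis_vertex i : i < 5 -> B (1 + i) (axis i) = true.
Proof.
  intros Hi.
  destruct (edge_line 0 (1 + i)) as [l [Hl [H0 HP]]]; [case5 Hi; reflexivity|].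
  destruct (centre_lines l) as [j [Hj ->]]; auto; [lia|].
  now rewrite (axis_vertex_eq j i Hj Hi HP) in HP.
Qed.

Lemma side_not_opposite i : i < 5 -> B (1 + i) (side i) <> true.
Proof.
  intros Hi H; destruct (axisP i Hi) as [Ha [_ H1]], (sideP i Hi) as [Hs [H2 _]].
  assert (H3 := axis_vertex i Hi).
  apply (axis_neq_side i i Hi Hi), (two_points (1 + i) (6 + i)); lia || assumption.
Qed.

Lemma pentagon_incidences : exists a s : nat -> nat, forall i, i < 5 ->
  (a i < 10 /\ B 0 (a i) = true /\ B (1 + i) (a i) = true /\ B (11 + i) (a i) = true /\
   forall j, j < 5 -> B (1 + j) (a i) = true -> i = j) /\
  (s i < 10 /\ B (1 + (i + 2) mod 5) (s i) = true /\ B (1 + (i + 3) mod 5) (s i) = true /\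
   B (11 + (i + 1) mod 5) (s i) = true /\ B (11 + (i + 4) mod 5) (s i) = true /\
   B (1 + i) (s i) <> true).
Proof.
  exists axis, side; intros i Hi.
  destruct (axisP i Hi) as [? [? _]], (sideP i Hi) as [? [_ ?]].
  repeat split; auto using axis_vertex, axis_tip, side_vertex3, side_tip1, side_tip4,
    side_not_opposite.
  intros j; now apply axis_vertex_eq.
Qed.

End Incidence.

(** * The golden ratio in a pentagon with concurrent axes *)


Lemma rational_sub x y : rational x -> rational y -> rational (x - y).
Proof. intros [p <-] [q <-]; exists (p - q)%Q; apply Q2R_minus. Qed.

Lemma rational_mul x y : rational x -> rational y -> rational (x * y).
Proof. intros [p <-] [q <-]; exists (p * q)%Q; apply Q2R_mult. Qed.

Lemma rational_div x y : y <> 0 -> rational x -> rational y -> rational (x / y).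
Proof.
  intros Hy [p <-] [q <-]; exists (p / q)%Q; apply Q2R_div.
  intros E; apply Hy; rewrite (Qeq_eqR _ _ E); apply RMicromega.Q2R_0.
Qed.

(** Infinite descent: 5 divides [a], hence also [b], and dividing both by 5 gives a smaller
    solution. *)
Lemma square_neq_5_square (b : nat) : forall a : Z,
  (0 < b)%nat -> (a * a <> 5 * (Z.of_nat b * Z.of_nat b))%Z.
Proof.
  induction b as [b IH] using lt_wf_ind; intros a Hb E.
  assert (H5 : forall x y : Z, (x * x = 5 * y -> exists x', x = 5 * x')%Z).
  { intros x y Hxy; exists (x / 5)%Z.
    assert (Hd := Z.div_mod x 5 ltac:(lia)); assert (Hm := Z.mod_pos_bound x 5 ltac:(lia)).
    set (m := (x mod 5)%Z) in *; set (d := (x / 5)%Z) in *; clearbody m d; subst x.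
    assert (m = 0 \/ m = 1 \/ m = 2 \/ m = 3 \/ m = 4)%Z as Hc by lia.
    destruct Hc as [-> | [-> | [-> | [-> | ->]]]]; lia. }
  destruct (H5 _ _ E) as [a' ->].
  destruct (H5 (Z.of_nat b) (a' * a')%Z ltac:(lia)) as [b' Hb'].
  apply (IH (Z.to_nat b')) with (a := a'); [lia | lia |].
  rewrite Z2Nat.id by lia; rewrite Hb' in E; lia.
Qed.

Lemma golden_irrational x : rational x -> x * x <> x + 1.
Proof.
  intros [[n d] Hx] E.
  assert (Hd : IZR (Zpos d) <> 0) by (apply not_0_IZR; lia).
  assert (Hxd : x * IZR (Zpos d) = IZR n).
  { rewrite <- Hx; unfold Q2R; simpl; field; exact Hd. }
  (* Completing the square gives [(2x - 1)^2 = 5]; with [x = n / d] this reads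
     [(2n - d)^2 = 5 d^2]. *)
  apply (square_neq_5_square (Pos.to_nat d) (2 * n - Zpos d)%Z); [lia|].
  rewrite positive_nat_Z; apply eq_IZR.
  rewrite !mult_IZR, minus_IZR, mult_IZR, <- Hxd.
  transitivity ((4 * (x * x) - 4 * x + 1) * (IZR (Zpos d) * IZR (Zpos d))); [ring|].
  rewrite E; ring.
Qed.

(** * Oriented areas and the relations at the tips *)

Definition orient (a b c : point) : R :=
  (fst b - fst a) * (snd c - snd a) - (snd b - snd a) * (fst c - fst a).

Lemma rational_orient a b c :
  rational (fst a) -> rational (snd a) -> rational (fst b) -> rational (snd b) ->
  rational (fst c) -> rational (snd c) -> rational (orient a b c).
Proof. intros; unfold orient; auto using rational_sub, rational_mul. Qed.

(** Write [t = o + r (q - o)]. Each of the lines [u v] and [w z] gives a linear equation for [r];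
    eliminating [r] leaves this identity. *)
Lemma tip_relation (o q t u v w z : point) :
  orient o q u <> 0 -> orient o q t = 0 -> orient t u v = 0 -> orient t w z = 0 ->
  orient o u v * (orient o q w + orient o z q) =
  orient o w z * (orient o q u + orient o v q).
Proof.
  unfold orient; destruct o as [o1 o2], q as [q1 q2], t as [t1 t2], u as [u1 u2],
    v as [v1 v2], w as [w1 w2], z as [z1 z2]; simpl; intros Hq Ht Huv Hwz.
  assert (Hr : exists r, t1 = o1 + r * (q1 - o1) /\ t2 = o2 + r * (q2 - o2)).
  { destruct (Req_dec (q1 - o1) 0) as [H1 | H1].
    - assert (H2 : q2 - o2 <> 0) by (intros H2; apply Hq; rewrite H1, H2; ring).
      exists ((t2 - o2) / (q2 - o2)); split; [|field; exact H2].
      apply (Rmult_eq_reg_l (q2 - o2)); [|exact H2].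
      rewrite H1 in Ht |- *; lra.
    - exists ((t1 - o1) / (q1 - o1)); split; [field; exact H1|].
      apply (Rmult_eq_reg_l (q1 - o1)); [|exact H1].
      transitivity ((q1 - o1) * o2 + (q2 - o2) * (t1 - o1)); [lra | field; exact H1]. }
  destruct Hr as [r [-> ->]]; clear Hq Ht; nsatz.
Qed.

(* The relations of [tip_relation] are linear in the weights [1] of the vertices and, by
   Pluecker, also hold for weights given by a linear form; so the weights may be replaced by
   the affine form [orient p0 p1], which vanishes at two of the five vertices. *)
Lemma tip_relation_affine (o p0 p1 q u v w z : point) :
  orient o u v * (orient o q w + orient o z q) =
  orient o w z * (orient o q u + orient o v q) ->
  orient o u v * (orient o q w * orient p0 p1 z + orient o z q * orient p0 p1 w) =
  orient o w z * (orient o q u * orient p0 p1 v + orient o v q * orient p0 p1 u).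
Proof.
  unfold orient; destruct o as [o1 o2], p0 as [a1 a2], p1 as [b1 b2], q as [q1 q2],
    u as [u1 u2], v as [v1 v2], w as [w1 w2], z as [z1 z2]; simpl; intros H; nsatz.
Qed.

(** The three-term Grassmann-Pluecker relation for the vectors from [o]. *)
Lemma pluecker (o a b c d : point) :
  orient o a b * orient o c d = orient o a c * orient o b d - orient o a d * orient o b c.
Proof. unfold orient; ring. Qed.

Lemma orient_swap (a b c : point) : orient a b c = - orient a c b.
Proof. unfold orient; ring. Qed.

(* Here [ci] and [ei] stand for [orient o p_i p_(i+1)] and [orient o p_i p_(i+2)]. *)
Lemma pentagon_golden (c0 c1 c2 c3 c4 e0 e1 e2 e3 e4 : R) :
  c1 <> 0 -> c2 <> 0 -> c4 <> 0 -> e0 <> 0 -> e1 <> 0 ->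
  c4 * e1 * c2 = c1 * e3 * c3 -> c1 * c3 * e0 = c0 * e2 * c2 ->
  c0 * c2 = e0 * e1 + c1 * e3 -> c1 * c3 = e1 * e2 + c2 * e4 ->
  c2 * c4 = e2 * e3 + c3 * e0 -> c3 * c0 = e3 * e4 + c4 * e1 ->
  c4 * c1 = e4 * e0 + c0 * e2 ->
  (c1 * e3) * (c1 * e3) = (c1 * e3) * (e0 * e1) + (e0 * e1) * (e0 * e1).
Proof.
  intros C1 C2 C4 E0 E1.
  (* The Rabinowitsch trick: each inequation becomes an equation with a fresh variable for the
     inverse, as [nsatz] works with equations. *)
  generalize (Rinv_l c1 C1) (Rinv_l c2 C2) (Rinv_l c4 C4) (Rinv_l e0 E0) (Rinv_l e1 E1).
  generalize (/ c1) (/ c2) (/ c4) (/ e0) (/ e1).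
  clear C1 C2 C4 E0 E1; intros; nsatz.
Qed.

Section Pentagon.
Variables (o : point) (p t : nat -> point).
Hypothesis tip_axis : forall i, (i < 5)%nat -> orient o (p i) (t i) = 0.
Hypothesis tip_right : forall i, (i < 5)%nat ->
  orient (t i) (p ((i + 1) mod 5)%nat) (p ((i + 2) mod 5)%nat) = 0.
Hypothesis tip_left : forall i, (i < 5)%nat ->
  orient (t i) (p ((i + 4) mod 5)%nat) (p ((i + 3) mod 5)%nat) = 0.
Hypothesis axes_distinct : forall i j, (i < 5)%nat -> (j < 5)%nat -> i <> j ->
  orient o (p i) (p j) <> 0.
Hypothesis vertex3_not_on_side : orient (p 0%nat) (p 1%nat) (p 3%nat) <> 0.

Let c i := orient o (p i) (p ((i + 1) mod 5)%nat).
Let e i := orient o (p i) (p ((i + 2) mod 5)%nat).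

Lemma weighted_tip_relation i : (i < 5)%nat ->
  let m j := orient (p 0%nat) (p 1%nat) (p j) in
  c ((i + 1) mod 5)%nat *
    (c ((i + 4) mod 5)%nat * m ((i + 3) mod 5)%nat
     - e ((i + 3) mod 5)%nat * m ((i + 4) mod 5)%nat) =
  c ((i + 3) mod 5)%nat *
    (c i * m ((i + 2) mod 5)%nat - e i * m ((i + 1) mod 5)%nat).
Proof.
  intros Hi m.
  assert (H := tip_relation o (p i) (t i) (p ((i + 1) mod 5)%nat) (p ((i + 2) mod 5)%nat)
                 (p ((i + 4) mod 5)%nat) (p ((i + 3) mod 5)%nat)).
  specialize (H ltac:(apply axes_distinct;
    destruct (lt5_cases _ Hi) as [-> | [-> | [-> | [-> | ->]]]]; vm_compute; lia)
    (tip_axis i Hi) (tip_right i Hi) (tip_left i Hi)).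
  apply (tip_relation_affine o (p 0%nat) (p 1%nat)) in H; revert H.
  unfold c, e, m.
  rewrite (orient_swap o (p ((i + 4) mod 5)%nat) (p ((i + 3) mod 5)%nat)),
    (orient_swap o (p i) (p ((i + 4) mod 5)%nat)),
    (orient_swap o (p ((i + 2) mod 5)%nat) (p i)).
  destruct (lt5_cases _ Hi) as [-> | [-> | [-> | [-> | ->]]]];
    cbn [Nat.add Nat.modulo Nat.divmod fst snd Nat.sub]; intros H; lra.
Qed.

(** With [[ij]] for [orient o (p i) (p j)], the quotient is [[12][30] / ([02][13])], up to sign a
    cross-ratio of axes 0 to 3. *)
Lemma golden_ratio : exists x, x * x = x + 1 /\ x = c 1%nat * e 3%nat / (e 0%nat * e 1%nat).
Proof.
  assert (Hc : forall i, (i < 5)%nat -> c i <> 0).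
  { intros i Hi; apply axes_distinct; auto;
      destruct (lt5_cases _ Hi) as [-> | [-> | [-> | [-> | ->]]]]; vm_compute; lia. }
  assert (He : forall i, (i < 5)%nat -> e i <> 0).
  { intros i Hi; apply axes_distinct; auto;
      destruct (lt5_cases _ Hi) as [-> | [-> | [-> | [-> | ->]]]]; vm_compute; lia. }
  assert (m0 : orient (p 0%nat) (p 1%nat) (p 0%nat) = 0) by (unfold orient; ring).
  assert (m1 : orient (p 0%nat) (p 1%nat) (p 1%nat) = 0) by (unfold orient; ring).
  (* Since the weights of vertices 0 and 1 vanish, the relations at tips 2, 3 and 4 shrink to two
     terms and the one at tip 0 to three. *)
  assert (A0 := weighted_tip_relation 0 ltac:(lia)).
  assert (A2 := weighted_tip_relation 2 ltac:(lia)).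
  assert (A3 := weighted_tip_relation 3 ltac:(lia)).
  assert (A4 := weighted_tip_relation 4 ltac:(lia)).
  cbn -[orient c e] in A0, A2, A3, A4.
  rewrite m1 in A0; rewrite m0, m1 in A2, A3, A4.
  revert A0 A2 A3 A4 vertex3_not_on_side.
  generalize (orient (p 0%nat) (p 1%nat) (p 2%nat)) (orient (p 0%nat) (p 1%nat) (p 3%nat))
    (orient (p 0%nat) (p 1%nat) (p 4%nat)); intros m2 m3 m4 A0 A2 A3 A4 Hm3.
  assert (P : forall i, (i < 5)%nat -> c i * c ((i + 2) mod 5)%nat =
    e i * e ((i + 1) mod 5)%nat + c ((i + 1) mod 5)%nat * e ((i + 3) mod 5)%nat).
  { intros i Hi; unfold c, e; rewrite pluecker.
    destruct (lt5_cases _ Hi) as [-> | [-> | [-> | [-> | ->]]]];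
    cbn -[orient]; unfold orient; ring. }
  assert (P0 := P 0%nat ltac:(lia)); assert (P1 := P 1%nat ltac:(lia));
  assert (P2 := P 2%nat ltac:(lia)); assert (P3 := P 3%nat ltac:(lia));
  assert (P4 := P 4%nat ltac:(lia)); clear P; cbn -[orient c e] in P0, P1, P2, P3, P4.
  assert (c0 := Hc 0%nat ltac:(lia)); assert (c1 := Hc 1%nat ltac:(lia));
  assert (c2 := Hc 2%nat ltac:(lia)); assert (c3 := Hc 3%nat ltac:(lia));
  assert (c4 := Hc 4%nat ltac:(lia)); assert (e0 := He 0%nat ltac:(lia));
  assert (e1 := He 1%nat ltac:(lia)); assert (e2 := He 2%nat ltac:(lia)).
  clearbody c e; clear - A0 A2 A3 A4 Hm3 P0 P1 P2 P3 P4 c0 c1 c2 c3 c4 e0 e1 e2.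
  assert (B2 : c 2%nat * m4 = e 2%nat * m3) by (apply (Rmult_eq_reg_l (c 0%nat)); lra).
  assert (B4 : c 3%nat * m2 = e 2%nat * m3) by (apply (Rmult_eq_reg_l (c 0%nat)); lra).
  assert (B3 : c 4%nat * e 1%nat * m2 = c 1%nat * e 3%nat * m4) by lra.
  (* [D1] and [D2] eliminate the weights: [m2] and [m4] are multiples of [m3] by [B4] and [B2], and
     the nonzero [m3] cancels. *)
  assert (D1 : c 4%nat * e 1%nat * c 2%nat = c 1%nat * e 3%nat * c 3%nat).
  { apply (Rmult_eq_reg_r (e 2%nat * m3)); [|now apply Rmult_integral_contrapositive].
    transitivity (c 4%nat * e 1%nat * m2 * (c 2%nat * c 3%nat)).
    - rewrite <- B4; ring.
    - rewrite B3, <- B2; ring. }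
  assert (D2 : c 1%nat * c 3%nat * e 0%nat = c 0%nat * e 2%nat * c 2%nat).
  { apply (Rmult_eq_reg_r m3); [|assumption].
    transitivity (c 0%nat * c 2%nat * (c 3%nat * m2)); [|rewrite B4; ring].
    transitivity (c 2%nat * (c 1%nat * (c 4%nat * m3 - e 3%nat * m4)));
      [|rewrite A0; ring].
    transitivity (c 1%nat * (c 2%nat * c 4%nat * m3 - e 3%nat * (c 2%nat * m4))); [|ring].
    rewrite B2, P2; ring. }
  exists (c 1%nat * e 3%nat / (e 0%nat * e 1%nat)); split; [|reflexivity].
  assert (G := pentagon_golden _ _ _ _ _ _ _ _ _ _ c1 c2 c4 e0 e1 D1 D2 P0 P1 P2 P3 P4).
  apply (Rmult_eq_reg_r ((e 0%nat * e 1%nat) * (e 0%nat * e 1%nat)));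
    [|now repeat apply Rmult_integral_contrapositive_currified].
  transitivity ((c 1%nat * e 3%nat) * (c 1%nat * e 3%nat)); [field; auto|].
  rewrite G; field; auto.
Qed.

Lemma pentagon_irrational :
  ~ (rational (fst o) /\ rational (snd o) /\
     forall i, (i < 5)%nat -> rational (fst (p i)) /\ rational (snd (p i))).
Proof.
  intros (Ho1 & Ho2 & Hp); destruct golden_ratio as (x & Hx & ->).
  revert Hx; apply golden_irrational.
  assert (Hd : forall i j, (i < 5)%nat -> (j < 5)%nat -> rational (orient o (p i) (p j))).
  { intros i j Hi Hj; destruct (Hp i Hi), (Hp j Hj); now apply rational_orient. }
  apply rational_div; [|apply rational_mul; apply Hd; vm_compute; lia ..].
  apply Rmult_integral_contrapositive_currified; apply axes_distinct; vm_compute; lia.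
Qed.

End Pentagon.

(** * Incidences of a straight-line drawing *)

Definition on_lineb (l : line) (X : point) : bool :=
  let '(a, b, c) := l in if Req_dec_T (a * fst X + b * snd X) c then true else false.

Lemma on_lineP l X : on_lineb l X = true <-> on_line l X.
Proof.
  destruct l as [[a b] c]; simpl; destruct (Req_dec_T (a * fst X + b * snd X) c);
    split; easy.
Qed.

Lemma on_line_orient l X Y Z : is_line l -> X <> Y -> on_line l X -> on_line l Y ->
  (on_line l Z <-> orient X Y Z = 0).
Proof.
  destruct l as [[a b] c], X as [x1 x2], Y as [y1 y2], Z as [z1 z2]; unfold orient; simpl.
  intros Hl Hne HX HY; split; intros H.
  - assert (Hx : y1 - x1 <> 0 \/ y2 - x2 <> 0).
    { destruct (Req_dec (y1 - x1) 0) as [H1 | H1]; auto.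
      destruct (Req_dec (y2 - x2) 0) as [H2 | H2]; auto.
      exfalso; apply Hne; f_equal; lra. }
    assert (HXY : a * (y1 - x1) + b * (y2 - x2) = 0) by lra.
    assert (HXZ : a * (z1 - x1) + b * (z2 - x2) = 0) by lra.
    destruct (Req_dec a 0) as [Ha | Ha].
    + apply (Rmult_eq_reg_l b); [|tauto].
      transitivity ((y1 - x1) * (a * (z1 - x1) + b * (z2 - x2))
        - (z1 - x1) * (a * (y1 - x1) + b * (y2 - x2))); [ring|].
      rewrite HXY, HXZ; ring.
    + apply (Rmult_eq_reg_l a); [|assumption].
      transitivity ((z2 - x2) * (a * (y1 - x1) + b * (y2 - x2))
        - (y2 - x2) * (a * (z1 - x1) + b * (z2 - x2))); [ring|].
      rewrite HXY, HXZ; ring.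
  - assert (HXY : a * (y1 - x1) + b * (y2 - x2) = 0) by lra.
    assert (HXZ : a * (z1 - x1) + b * (z2 - x2) = 0); [|lra].
    destruct (Req_dec (y1 - x1) 0) as [H1 | H1].
    + assert (H2 : y2 - x2 <> 0) by (intros H2; apply Hne; f_equal; lra).
      apply (Rmult_eq_reg_l (y2 - x2)); [|assumption].
      transitivity ((z2 - x2) * (a * (y1 - x1) + b * (y2 - x2))
        - a * ((y1 - x1) * (z2 - x2) - (y2 - x2) * (z1 - x1))); [ring|].
      rewrite HXY, H; ring.
    + apply (Rmult_eq_reg_l (y1 - x1)); [|assumption].
      transitivity ((z1 - x1) * (a * (y1 - x1) + b * (y2 - x2))
        + b * ((y1 - x1) * (z2 - x2) - (y2 - x2) * (z1 - x1))); [ring|].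
      rewrite HXY, H; ring.
Qed.

(** Extensional, because proportional triples describe the same line. *)
Definition same_line (l l' : line) : Prop := forall X, on_line l X <-> on_line l' X.

Lemma two_points_same_line l l' X Y : is_line l -> is_line l' -> X <> Y ->
  on_line l X -> on_line l Y -> on_line l' X -> on_line l' Y -> same_line l l'.
Proof.
  intros Hl Hl' Hne H1 H2 H3 H4 Z.
  rewrite (on_line_orient l X Y), (on_line_orient l' X Y); tauto.
Qed.

(** Counting pairs of lines needs different indices to mean different lines. *)
Lemma remove_repeated_lines (L : list line) : exists L',
  (length L' <= length L)%nat /\ incl L' L /\
  (forall l, In l L -> exists l', In l' L' /\ same_line l l') /\
  (forall i j d, (i < length L')%nat -> (j < length L')%nat ->
     same_line (nth i L' d) (nth j L' d) -> i = j).
Proof.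
  induction L as [|l L [L' (Hlen & Hincl & Hall & Hdist)]].
  - exists []; repeat split; simpl; try easy; lia.
  - destruct (classic (exists l', In l' L' /\ same_line l l')) as [Hl | Hl].
    + exists L'; repeat split; simpl; auto.
      * intros x Hx; right; auto.
      * intros x [<- | Hx]; auto.
    + exists (l :: L'); repeat split; simpl; try lia.
      * intros x [<- | Hx]; [now left | right; auto].
      * intros x [<- | Hx]; [exists l; split; [now left | easy]|].
        destruct (Hall x Hx) as [l' [? ?]]; exists l'; auto.
      * intros [|i] [|j] d Hi Hj Hs; auto.
        -- exfalso; apply Hl; exists (nth j L' d); split; [apply nth_In; lia | easy].
        -- exfalso; apply Hl; exists (nth i L' d); split; [apply nth_In; lia|].
           intros X; symmetry; apply Hs.
        -- f_equal; apply (Hdist i j d); auto; lia.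
Qed.

Definition between (P Q : point) (t : R) : point :=
  ((1 - t) * fst P + t * fst Q, (1 - t) * snd P + t * snd Q).

(* A line that does not contain the whole segment meets it at most once, so it can be
   discarded after passing to a subinterval. *)
Lemma covered_segment (P Q : point) (L : list line) : forall a b, a < b ->
  (forall t, a <= t <= b -> exists l, In l L /\ on_line l (between P Q t)) ->
  exists l, In l L /\ on_line l P /\ on_line l Q.
Proof.
  induction L as [|l L IH]; intros a b Hab H.
  - destruct (H a) as [l [[] _]]; lra.
  - destruct (classic (on_line l P /\ on_line l Q)) as [Hl | Hl].
    { exists l; split; [now left | exact Hl]. }
    assert (Huniq : forall s t, s < t ->
      on_line l (between P Q s) -> on_line l (between P Q t) -> False).
    { intros s t Hst Hs Ht; apply Hl; destruct l as [[x y] z]; simpl in *.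
      assert (E : x * (fst Q - fst P) + y * (snd Q - snd P) = 0).
      { apply (Rmult_eq_reg_l (t - s)); lra. }
      assert (E' : forall r, r * (x * (fst Q - fst P) + y * (snd Q - snd P)) = 0).
      { intros r; rewrite E; ring. }
      assert (E1 := E' s); lra. }
    (* If the line is met in the first third, the last third avoids it by [Huniq]; otherwise the
       first third does. *)
    assert (Hsub : exists a' b', a' < b' /\ a <= a' /\ b' <= b /\
      forall t, a' <= t <= b' -> ~ on_line l (between P Q t)).
    { destruct (classic (exists t, a <= t <= a + (b - a) / 3 /\ on_line l (between P Q t)))
        as [[s [Hs Hls]] | Hno].
      - exists (b - (b - a) / 3), b; repeat split; try lra.
        intros t Ht Hlt; apply (Huniq s t); auto; lra.
      - exists a, (a + (b - a) / 3); repeat split; try lra.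
        intros t Ht Hlt; apply Hno; exists t; auto. }
    destruct Hsub as (a' & b' & Hab' & Ha & Hb & Hno).
    destruct (IH a' b' Hab') as [l' [Hin Hl']].
    + intros t Ht; destruct (H t ltac:(lra)) as [l' [[<- | Hin] Hl']];
        [now apply Hno in Hl' | now exists l'].
    + exists l'; split; [now right | exact Hl'].
Qed.

Lemma on_seg_sym P Q X : on_seg P Q X -> on_seg Q P X.
Proof. intros [t [Ht [H1 H2]]]; exists (1 - t); rewrite H1, H2; repeat split; lra. Qed.

Definition along (V D : point) (r : R) : point := (fst V + r * fst D, snd V + r * snd D).

Lemma collinear_along V A X : V <> A -> orient V A X = 0 ->
  exists r, X = along V (fst A - fst V, snd A - snd V) r.
Proof.
  destruct V as [v1 v2], A as [a1 a2], X as [x1 x2]; unfold orient, along; simpl.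
  intros Hne H; destruct (Req_dec (a1 - v1) 0) as [H1 | H1].
  - assert (H2 : a2 - v2 <> 0) by (intros H2; apply Hne; f_equal; lra).
    exists ((x2 - v2) / (a2 - v2)); f_equal; [|field; exact H2].
    apply (Rmult_eq_reg_l (a2 - v2)); [|exact H2].
    rewrite H1 in H |- *; lra.
  - exists ((x1 - v1) / (a1 - v1)); f_equal; [field; exact H1|].
    apply (Rmult_eq_reg_l (a1 - v1)); [|exact H1].
    transitivity ((a1 - v1) * v2 + (a2 - v2) * (x1 - v1)); [lra | field; exact H1].
Qed.

Lemma on_seg_along V D r s t : r < t -> r <= s <= t ->
  on_seg (along V D r) (along V D t) (along V D s).
Proof.
  intros Hrt Hs; exists ((s - r) / (t - r)); repeat split.
  - apply Rmult_le_pos; [lra | left; apply Rinv_0_lt_compat; lra].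
  - apply (Rmult_le_reg_r (t - r)); [lra|].
    replace ((s - r) / (t - r) * (t - r)) with (s - r) by (field; lra); lra.
  - simpl; field; lra.
  - simpl; field; lra.
Qed.

Section Drawing.
Variables (G : graph) (p : nat -> point).
Hypothesis drawn : drawing G p.

Lemma edge_avoids u v w : adj G u v -> (w < nv G)%nat -> w <> u -> w <> v ->
  ~ on_seg (p u) (p v) (p w).
Proof. destruct drawn as [_ [H _]]; apply H. Qed.

Lemma vertices_distinct u v : (u < nv G)%nat -> (v < nv G)%nat -> u <> v -> p u <> p v.
Proof. destruct drawn as [H _]; intros Hu Hv Hne E; apply Hne, H; auto. Qed.

(** Betweenness on a common line becomes the order of real parameters, so the collinear cases below
    reduce to [lra]. *)
Lemma edge_avoids_along V D u v w r s t : adj G u v -> (w < nv G)%nat -> w <> u -> w <> v ->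
  p u = along V D r -> p w = along V D s -> p v = along V D t ->
  ~ (r <= s <= t \/ t <= s <= r).
Proof.
  intros Huv Hw Hwu Hwv Eu Ew Ev H.
  destruct (adj_range G _ _ Huv) as [Hu Hv].
  assert (Huv' : u <> v) by (intros ->; now apply (adj_irrefl G v)).
  assert (Hrt : r <> t).
  { intros ->; apply (vertices_distinct u v); congruence. }
  apply (edge_avoids u v w Huv Hw Hwu Hwv); rewrite Eu, Ew, Ev.
  destruct H as [H | H]; [apply on_seg_along; lra|].
  apply on_seg_sym, on_seg_along; lra.
Qed.

Lemma line_along l u v : is_line l -> (u < nv G)%nat -> (v < nv G)%nat -> u <> v ->
  on_line l (p u) -> on_line l (p v) -> exists D,
  p u = along (p u) D 0 /\ p v = along (p u) D 1 /\
  forall w, on_line l (p w) -> exists r, p w = along (p u) D r.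
Proof.
  intros Hl Hu Hv Hne Lu Lv.
  assert (Hp := vertices_distinct u v Hu Hv Hne).
  exists (fst (p v) - fst (p u), snd (p v) - snd (p u)); repeat split.
  - unfold along; destruct (p u); simpl; f_equal; ring.
  - unfold along; destruct (p v); simpl; f_equal; ring.
  - intros w Lw; apply collinear_along; auto.
    now apply (on_line_orient l).
Qed.

(** One of three collinear points lies between the other two, hence on the edge that joins them. *)
Lemma flat_triangle u v w l : adj G u v -> adj G v w -> adj G u w -> is_line l ->
  on_line l (p u) -> on_line l (p v) -> on_line l (p w) -> False.
Proof.
  intros Huv Hvw Huw Hl Lu Lv Lw.
  assert (Nuv : u <> v) by (intros ->; now apply (adj_irrefl G v)).
  assert (Nvw : v <> w) by (intros ->; now apply (adj_irrefl G w)).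
  assert (Nuw : u <> w) by (intros ->; now apply (adj_irrefl G w)).
  destruct (adj_range G _ _ Huv) as [Hu Hv], (adj_range G _ _ Hvw) as [_ Hw].
  destruct (line_along l u v) as (D & Eu & Ev & Hr); auto.
  destruct (Hr w Lw) as [r Ew].
  assert (H1 := edge_avoids_along _ _ u v w _ _ _ Huv Hw ltac:(auto) ltac:(auto) Eu Ew Ev).
  assert (H2 := edge_avoids_along _ _ u w v _ _ _ Huw Hv ltac:(auto) ltac:(auto) Eu Ev Ew).
  assert (H3 := edge_avoids_along _ _ v w u _ _ _ Hvw Hu ltac:(auto) ltac:(auto) Ev Eu Ew).
  lra.
Qed.

(** Two of the three neighbours lie on the same side of [v], and the nearer one is on the edge to
    the farther. *)
Lemma three_collinear_neighbours v x y z l : x <> y -> x <> z -> y <> z ->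
  adj G v x -> adj G v y -> adj G v z -> is_line l ->
  on_line l (p v) -> on_line l (p x) -> on_line l (p y) -> on_line l (p z) -> False.
Proof.
  intros Nxy Nxz Nyz Ax Ay Az Hl Lv Lx Ly Lz.
  assert (Nvx : v <> x) by (intros ->; now apply (adj_irrefl G x)).
  destruct (adj_range G _ _ Ax) as [Hv Hx], (adj_range G _ _ Ay) as [_ Hy],
    (adj_range G _ _ Az) as [_ Hz].
  destruct (line_along l v x) as (D & Ev & Ex & Hr); auto.
  destruct (Hr y Ly) as [r Ey], (Hr z Lz) as [s Ez].
  assert (Nvy : y <> v) by (intros ->; now apply (adj_irrefl G v)).
  assert (Nvz : z <> v) by (intros ->; now apply (adj_irrefl G v)).
  assert (H1 := edge_avoids_along _ _ v x y _ _ _ Ax Hy ltac:(auto) ltac:(auto) Ev Ey Ex).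
  assert (H2 := edge_avoids_along _ _ v x z _ _ _ Ax Hz ltac:(auto) ltac:(auto) Ev Ez Ex).
  assert (H3 := edge_avoids_along _ _ v y x _ _ _ Ay Hx ltac:(auto) ltac:(auto) Ev Ex Ey).
  assert (H4 := edge_avoids_along _ _ v y z _ _ _ Ay Hz ltac:(auto) ltac:(auto) Ev Ez Ey).
  assert (H5 := edge_avoids_along _ _ v z x _ _ _ Az Hx ltac:(auto) ltac:(auto) Ev Ex Ez).
  assert (H6 := edge_avoids_along _ _ v z y _ _ _ Az Hy ltac:(auto) ltac:(auto) Ev Ey Ez).
  lra.
Qed.

Lemma edge_on_line L u v : covered_by G p L -> adj G u v ->
  exists l, In l L /\ on_line l (p u) /\ on_line l (p v).
Proof.
  intros (_ & _ & Hcov) Huv; apply (covered_segment _ _ L 0 1); [lra|].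
  intros t Ht; apply (Hcov u v _ Huv); exists t; now repeat split.
Qed.

End Drawing.

(** * The incidence argument applied to drawings of the pentagon graph *)

Section Pentagon_drawing.
Variables (p : nat -> point) (L : list line).
Hypothesis drawn : drawing pentagon_graph p.
Hypothesis covered : covered_by pentagon_graph p L.
Hypothesis lines_distinct : forall i j d, (i < length L)%nat -> (j < length L)%nat ->
  same_line (nth i L d) (nth j L d) -> i = j.

Let line_at i := nth i L (0, 0, 0).
Let B v i := on_lineb (line_at i) (p v).

Lemma line_at_is_line i : (i < length L)%nat -> is_line (line_at i).
Proof.
  intros Hi; destruct covered as [Hl _]; rewrite Forall_forall in Hl.
  apply Hl, nth_In; exact Hi.
Qed.

Lemma drawing_two_points u v i j : (u < 26)%nat -> (v < 26)%nat ->
  (i < length L)%nat -> (j < length L)%nat -> u <> v ->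
  B u i = true -> B v i = true -> B u j = true -> B v j = true -> i = j.
Proof.
  unfold B; rewrite !on_lineP; intros Hu Hv Hi Hj Hne H1 H2 H3 H4.
  apply (lines_distinct i j (0, 0, 0) Hi Hj), (two_points_same_line _ _ (p u) (p v)); auto;
    try now apply line_at_is_line.
  now apply (vertices_distinct pentagon_graph).
Qed.

Lemma drawing_edge_line u v : adjb u v = true ->
  exists i, (i < length L)%nat /\ B u i = true /\ B v i = true.
Proof.
  intros Huv; destruct (edge_on_line pentagon_graph p L u v covered Huv) as [l [Hin H]].
  apply (In_nth _ _ (0, 0, 0)) in Hin as [i [Hi <-]]; exists i.
  unfold B; rewrite !on_lineP; auto.
Qed.

Lemma drawing_two_neighbours v x y z i : x <> y -> x <> z -> y <> z ->
  adjb v x = true -> adjb v y = true -> adjb v z = true -> (i < length L)%nat ->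
  B v i = true -> B x i = true -> B y i = true -> B z i = true -> False.
Proof.
  unfold B; rewrite !on_lineP; intros N1 N2 N3 A1 A2 A3 Hi.
  apply (three_collinear_neighbours pentagon_graph); auto; now apply line_at_is_line.
Qed.

Lemma drawing_no_flat_triangle u v w i :
  adjb u v = true -> adjb v w = true -> adjb u w = true -> (i < length L)%nat ->
  B u i = true -> B v i = true -> B w i = true -> False.
Proof.
  unfold B; rewrite !on_lineP; intros A1 A2 A3 Hi.
  apply (flat_triangle pentagon_graph); auto; now apply line_at_is_line.
Qed.

Lemma drawing_lines_ge : (10 <= length L)%nat.
Proof.
  exact (lines_ge (length L) B drawing_two_points drawing_edge_line
           drawing_two_neighbours).
Qed.

Lemma drawing_irrational : length L = 10%nat ->
  ~ forall v, (v < 26)%nat -> rational (fst (p v)) /\ rational (snd (p v)).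
Proof.
  intros H10 Hrat.
  destruct (pentagon_incidences (length L) B drawing_two_points drawing_edge_line
    drawing_two_neighbours drawing_no_flat_triangle H10) as (a & s & Has).
  assert (Hcol : forall l u v w, (l < 10)%nat -> (u < 26)%nat -> (v < 26)%nat -> u <> v ->
    B u l = true -> B v l = true -> (B w l = true <-> orient (p u) (p v) (p w) = 0)).
  { unfold B; intros l u v w Hl Hu Hv Hne; rewrite !on_lineP; intros Lu Lv.
    apply on_line_orient; auto; [apply line_at_is_line; lia|].
    now apply (vertices_distinct pentagon_graph). }
  assert (Hmod : forall n, (n mod 5 < 5)%nat) by (intros n; apply Nat.mod_upper_bound; lia).
  apply (pentagon_irrational (p 0%nat) (fun i => p (1 + i)%nat) (fun i => p (11 + i)%nat)).
  - intros i Hi; destruct (Has i Hi) as [(Ha & H0 & HP & HT & _) _].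
    apply (Hcol (a i)); auto; lia.
  (* Tip [i] lies on side [i + 4], which carries vertices [i + 1] and [i + 2], and, for the next
     goal, on side [i + 1] with vertices [i + 3] and [i + 4]. *)
  - intros i Hi; destruct (Has _ (Hmod (i + 4)%nat)) as [_ (Hs & H2 & H3 & H1 & H4 & _)].
    apply (Hcol (s ((i + 4) mod 5)%nat)); auto;
      destruct (lt5_cases _ Hi) as [-> | [-> | [-> | [-> | ->]]]]; assumption || (cbn; lia).
  - intros i Hi; destruct (Has _ (Hmod (i + 1)%nat)) as [_ (Hs & H2 & H3 & H1 & H4 & _)].
    apply (Hcol (s ((i + 1) mod 5)%nat)); auto;
      destruct (lt5_cases _ Hi) as [-> | [-> | [-> | [-> | ->]]]]; assumption || (cbn; lia).
  - intros i j Hi Hj Hne E; destruct (Has i Hi) as [(Ha & H0 & HP & _ & Hj') _].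
    apply Hne, Hj'; auto; apply (Hcol (a i) 0%nat (1 + i)%nat); auto; lia.
  (* Side 3 joins vertices 0 and 1 and is opposite to vertex 3. *)
  - intros E; destruct (Has 3%nat ltac:(lia)) as [_ (Hs & H2 & H3 & _ & _ & Hno)].
    apply Hno, (Hcol (s 3%nat) 1%nat 2%nat); auto; lia.
  - destruct (Hrat 0%nat ltac:(lia)); split; [|split]; auto.
    intros i Hi; apply Hrat; lia.
Qed.

End Pentagon_drawing.

Lemma covered_by_subset G p L L' : covered_by G p L -> incl L' L ->
  (forall l, In l L -> exists l', In l' L' /\ same_line l l') -> covered_by G p L'.
Proof.
  intros (HL & HV & HE) Hincl Hsame.
  assert (Hmove : forall X, (exists l, In l L /\ on_line l X) ->
                            exists l, In l L' /\ on_line l X).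
  { intros X [l [Hl HX]]; destruct (Hsame l Hl) as [l' [Hl' Hs]].
    exists l'; split; [exact Hl' | now apply Hs]. }
  split; [|split].
  - rewrite Forall_forall in *; auto.
  - auto.
  - eauto.
Qed.

(** * The regular pentagon *)

Definition dot (a b c : point) : R :=
  (fst b - fst a) * (fst c - fst a) + (snd b - snd a) * (snd c - snd a).

Lemma on_seg_orient P Q X : on_seg P Q X -> orient P Q X = 0.
Proof. unfold orient; intros [t [_ [-> ->]]]; ring. Qed.

Lemma on_seg_dot P Q X : on_seg P Q X -> dot X P Q <= 0.
Proof.
  unfold dot; intros [t [Ht [-> ->]]].
  assert (0 <= t * (1 - t) * ((fst Q - fst P)² + (snd Q - snd P)²)).
  { apply Rmult_le_pos; [apply Rmult_le_pos; lra|].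
    apply Rplus_le_le_0_compat; apply Rle_0_sqr. }
  unfold Rsqr in *; lra.
Qed.

Lemma on_seg_orient_pos A B C D X :
  0 < orient A B C -> 0 < orient A B D -> on_seg C D X -> 0 < orient A B X.
Proof.
  intros HC HD [t [Ht [HX1 HX2]]].
  replace (orient A B X) with ((1 - t) * orient A B C + t * orient A B D)
    by (unfold orient; rewrite HX1, HX2; ring).
  destruct (Req_dec t 0) as [-> | Ht0]; [lra|].
  apply Rplus_le_lt_0_compat; [apply Rmult_le_pos; lra | apply Rmult_lt_0_compat; lra].
Qed.

Lemma on_seg_dot_neg A B C D X :
  dot A B C < 0 -> dot A B D < 0 -> on_seg C D X -> dot A B X < 0.
Proof.
  intros HC HD [t [Ht [HX1 HX2]]].
  replace (dot A B X) with ((1 - t) * dot A B C + t * dot A B D)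
    by (unfold dot; rewrite HX1, HX2; ring).
  destruct (Req_dec t 0) as [-> | Ht0]; [lra|].
  assert (0 <= (1 - t) * - dot A B C) by (apply Rmult_le_pos; lra).
  assert (0 < t * - dot A B D) by (apply Rmult_lt_0_compat; lra).
  lra.
Qed.

Lemma on_seg_dot_start A B X : on_seg A B X -> 0 <= dot A B X.
Proof.
  intros [t [Ht [HX1 HX2]]].
  replace (dot A B X) with (t * ((fst B - fst A)² + (snd B - snd A)²))
    by (unfold dot, Rsqr; rewrite HX1, HX2; ring).
  apply Rmult_le_pos; [lra | apply Rplus_le_le_0_compat; apply Rle_0_sqr].
Qed.

(** For [X = A + t (C - A)], both [orient A B X] and [dot A B X] scale with [t]; the first must be 0
    and the second nonnegative, so either alternative forces [t = 0]. *)
Lemma segments_from_common_end A B C X : orient A B C <> 0 \/ dot A B C < 0 ->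
  on_seg A B X -> on_seg A C X -> X = A.
Proof.
  intros H HB HC; assert (HX := on_seg_orient _ _ _ HB).
  assert (HX0 := on_seg_dot_start _ _ _ HB).
  destruct HC as [t [Ht [H1 H2]]].
  replace (orient A B X) with (t * orient A B C) in HX
    by (unfold orient; rewrite H1, H2; ring).
  replace (dot A B X) with (t * dot A B C) in HX0
    by (unfold dot; rewrite H1, H2; ring).
  assert (t = 0).
  { destruct H as [H | H]; [apply Rmult_integral in HX; tauto|].
    destruct (Req_dec t 0) as [|Ht0]; auto.
    assert (0 < t * - dot A B C) by (apply Rmult_lt_0_compat; lra); lra. }
  subst t; destruct X, A; simpl in *; f_equal; lra.
Qed.

(* The pair [(a, b)] stands for [a + b * tau], where [tau = 2 cos 72] is the positive root
   of [x^2 + x = 1]. *)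
Definition ztau : Type := (Z * Z)%type.
Definition tau : R := (sqrt 5 - 1) / 2.
Definition value (z : ztau) : R := IZR (fst z) + IZR (snd z) * tau.

Lemma tau_square : tau * tau = 1 - tau.
Proof. unfold tau; assert (H := sqrt_sqrt 5 ltac:(lra)); lra. Qed.

Definition zadd (x y : ztau) : ztau := (fst x + fst y, snd x + snd y)%Z.
Definition zsub (x y : ztau) : ztau := (fst x - fst y, snd x - snd y)%Z.
Definition zmul (x y : ztau) : ztau :=
  (fst x * fst y + snd x * snd y, fst x * snd y + snd x * fst y - snd x * snd y)%Z.

Lemma value_add x y : value (zadd x y) = value x + value y.
Proof. unfold value, zadd; simpl; rewrite !plus_IZR; ring. Qed.

Lemma value_sub x y : value (zsub x y) = value x - value y.
Proof. unfold value, zsub; simpl; rewrite !minus_IZR; ring. Qed.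

Lemma value_mul x y : value (zmul x y) = value x * value y.
Proof.
  unfold value, zmul; simpl; rewrite minus_IZR, !plus_IZR, !mult_IZR.
  transitivity (IZR (fst x) * IZR (fst y) + IZR (snd x) * IZR (snd y) * (1 - tau)
    + (IZR (fst x) * IZR (snd y) + IZR (snd x) * IZR (fst y)) * tau); [ring|].
  rewrite <- tau_square; ring.
Qed.

(* With [u = 2 * a - b], [2 * (a + b * tau) = u + b * sqrt 5]. *)
Definition zpos (z : ztau) : bool :=
  let b := snd z in let u := (2 * fst z - b)%Z in
  ((0 <? u) && (0 <=? b) || (0 <=? u) && (0 <? b)
   || (0 <? u) && (5 * (b * b) <? u * u) || (0 <? b) && (u * u <? 5 * (b * b)))%Z.

Lemma zposP z : zpos z = true -> 0 < value z.
Proof.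
  destruct z as [a b]; unfold zpos, value, tau; cbn [fst snd].
  assert (Hs : 0 < sqrt 5) by (apply sqrt_lt_R0; lra).
  assert (H5 := sqrt_sqrt 5 ltac:(lra)).
  set (s := sqrt 5) in *; clearbody s.
  rewrite !Bool.orb_true_iff, !Bool.andb_true_iff, !Z.ltb_lt, !Z.leb_le.
  intros H.
  assert (Hu : IZR a + IZR b * ((s - 1) / 2) = (IZR (2 * a - b) + IZR b * s) / 2)
    by (rewrite minus_IZR, mult_IZR; field).
  rewrite Hu; set (u := (2 * a - b)%Z) in *; clearbody u; clear Hu.
  destruct H as [[[[H1 H2] | [H1 H2]] | [H1 H2]] | [H1 H2]];
    [apply IZR_lt in H1; apply IZR_le in H2 | apply IZR_le in H1; apply IZR_lt in H2
    | apply IZR_lt in H1, H2; rewrite !mult_IZR in H2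
    | apply IZR_lt in H1, H2; rewrite !mult_IZR in H2];
    (enough (0 < IZR u + IZR b * s) by lra); set (x := IZR u) in *; set (y := IZR b) in *;
    clearbody x y.
  - assert (0 <= y * s) by (apply Rmult_le_pos; lra); lra.
  - assert (0 < y * s) by (apply Rmult_lt_0_compat; lra); lra.
  - apply Rnot_le_lt; intros Hle; assert (x * x <= (- (y * s)) * (- (y * s))) by nra; nra.
  - assert (0 < y * s) by (apply Rmult_lt_0_compat; lra).
    apply Rnot_le_lt; intros Hle; assert ((y * s) * (y * s) <= x * x) by nra; nra.
Qed.

(** * Decidable segment tests with coordinates [a + b * tau] *)

Definition zpoint : Type := (ztau * ztau)%type.
Definition realize (P : zpoint) : point := (value (fst P), value (snd P)).

Definition psub (P Q : zpoint) : zpoint := (zsub (fst P) (fst Q), zsub (snd P) (snd Q)).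
Definition pscale (x : ztau) (P : zpoint) : zpoint := (zmul x (fst P), zmul x (snd P)).

Definition zorient (A B C : zpoint) : ztau :=
  let U := psub B A in let V := psub C A in
  zsub (zmul (fst U) (snd V)) (zmul (snd U) (fst V)).
Definition zdot (A B C : zpoint) : ztau :=
  let U := psub B A in let V := psub C A in
  zadd (zmul (fst U) (fst V)) (zmul (snd U) (snd V)).

Lemma value_orient A B C : value (zorient A B C) = orient (realize A) (realize B) (realize C).
Proof.
  unfold zorient, orient, psub; simpl; rewrite value_sub, !value_mul, !value_sub; reflexivity.
Qed.

Lemma value_dot A B C : value (zdot A B C) = dot (realize A) (realize B) (realize C).
Proof.
  unfold zdot, dot, psub; simpl; rewrite value_add, !value_mul, !value_sub; reflexivity.
Qed.

Definition zneg (z : ztau) : bool := zpos (zsub (0, 0)%Z z).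

Lemma znegP z : zneg z = true -> value z < 0.
Proof.
  intros H; apply zposP in H; rewrite value_sub in H.
  replace (value (0, 0)%Z) with 0 in H by (unfold value; simpl; ring); lra.
Qed.

Definition nonzero (z : ztau) : bool := zpos z || zneg z.

Lemma nonzeroP z : nonzero z = true -> value z <> 0.
Proof.
  unfold nonzero; intros H; apply Bool.orb_prop in H as [H | H];
    [apply zposP in H | apply znegP in H]; lra.
Qed.

Definition is_zero (z : ztau) : bool := ((fst z =? 0) && (snd z =? 0))%Z.

Lemma is_zeroP z : is_zero z = true -> value z = 0.
Proof.
  destruct z as [a b]; unfold is_zero, value; simpl; rewrite Bool.andb_true_iff, !Z.eqb_eq.
  intros [-> ->]; ring.
Qed.

Definition distinct (A B : zpoint) : bool :=
  nonzero (zsub (fst A) (fst B)) || nonzero (zsub (snd A) (snd B)).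

Lemma distinctP A B : distinct A B = true -> realize A <> realize B.
Proof.
  unfold distinct, realize; intros H E; injection E as E1 E2.
  apply Bool.orb_prop in H as [H | H]; apply nonzeroP in H; rewrite value_sub in H; lra.
Qed.

Definition off_segment (A B C : zpoint) : bool := nonzero (zorient A B C) || zpos (zdot C A B).

Lemma off_segmentP A B C : off_segment A B C = true ->
  ~ on_seg (realize A) (realize B) (realize C).
Proof.
  intros H HC; apply Bool.orb_prop in H as [H | H].
  - apply nonzeroP in H; rewrite value_orient in H; now apply on_seg_orient in HC.
  - apply zposP in H; rewrite value_dot in H; apply on_seg_dot in HC; lra.
Qed.

Definition diverging (A B C : zpoint) : bool := nonzero (zorient A B C) || zneg (zdot A B C).

Lemma divergingP A B C X : diverging A B C = true ->
  on_seg (realize A) (realize B) X -> on_seg (realize A) (realize C) X -> X = realize A.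
Proof.
  intros H; apply segments_from_common_end; apply Bool.orb_prop in H as [H | H].
  - left; apply nonzeroP in H; now rewrite value_orient in H.
  - right; apply znegP in H; now rewrite value_dot in H.
Qed.

Definition beside (A B C D : zpoint) : bool :=
  zpos (zorient A B C) && zpos (zorient A B D).
Definition behind (A B C D : zpoint) : bool := zneg (zdot A B C) && zneg (zdot A B D).

(** Sufficient tests by a separating line: the line of one of the segments, or, for collinear
    segments in particular, a perpendicular at an end of [A B]. *)
Definition apart (A B C D : zpoint) : bool :=
  beside A B C D || beside B A C D || beside C D A B || beside D C A B
  || behind A B C D || behind B A C D.

Lemma besideP A B C D X : beside A B C D = true ->
  on_seg (realize A) (realize B) X -> on_seg (realize C) (realize D) X -> False.
Proof.
  intros H HB HD; apply andb_prop in H as [H1 H2]; apply zposP in H1, H2.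
  rewrite value_orient in H1, H2; apply on_seg_orient in HB.
  assert (HX := on_seg_orient_pos _ _ _ _ _ H1 H2 HD); lra.
Qed.

Lemma behindP A B C D X : behind A B C D = true ->
  on_seg (realize A) (realize B) X -> on_seg (realize C) (realize D) X -> False.
Proof.
  intros H HB HD; apply andb_prop in H as [H1 H2]; apply znegP in H1, H2.
  rewrite value_dot in H1, H2; apply on_seg_dot_start in HB.
  assert (HX := on_seg_dot_neg _ _ _ _ _ H1 H2 HD); lra.
Qed.

Lemma apartP A B C D X : apart A B C D = true ->
  on_seg (realize A) (realize B) X -> on_seg (realize C) (realize D) X -> False.
Proof.
  unfold apart; rewrite !Bool.orb_true_iff; intros H HB HD.
  assert (HB' := on_seg_sym _ _ _ HB); assert (HD' := on_seg_sym _ _ _ HD).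
  destruct H as [[[[[H | H] | H] | H] | H] | H];
    (eapply besideP in H || eapply behindP in H); eassumption.
Qed.

(** * The placement of the vertices and its verification *)

Definition pentagon_vertex (i : nat) : zpoint :=
  nth i [((1, 0), (0, 0)); ((0, 0), (1, 0)); ((-1, 0), (0, 1));
         ((0, -1), (0, -1)); ((0, 1), (-1, 0))]%Z ((0, 0), (0, 0))%Z.

(* The regular pentagon with centre [0], in the affine basis of its vertices 0 and 1, where
   [vertex (i+1) + vertex (i-1) = tau * vertex i].  Relative to vertex [i], the opposite
   midpoint has the factor [- (1 + tau) / 2] and the tip the factor [- (2 + tau)]; all
   coordinates are doubled so that the midpoints are integral. *)
Definition placement (v : nat) : zpoint :=
  let tip i := pscale (-4, -2)%Z (pentagon_vertex i) in
  let beyond i j := psub (pscale (2, 0)%Z (tip i)) (pscale (2, 0)%Z (pentagon_vertex j)) in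
  nth v ([((0, 0), (0, 0))%Z]
         ++ map (fun i => pscale (2, 0)%Z (pentagon_vertex i)) (seq 0 5)
         ++ map (fun i => pscale (-1, -1)%Z (pentagon_vertex i)) (seq 0 5)
         ++ map tip (seq 0 5)
         ++ map (fun i => beyond i ((i + 2) mod 5)%nat) (seq 0 5)
         ++ map (fun i => beyond i ((i + 3) mod 5)%nat) (seq 0 5)) ((0, 0), (0, 0))%Z.

Definition pentagon_placement (v : nat) : point := realize (placement v).

Definition meet_ok (a b c d : nat) : bool :=
  let P := placement in
  if (a =? c)%nat then (b =? d)%nat || diverging (P a) (P b) (P d)
  else if (a =? d)%nat then (b =? c)%nat || diverging (P a) (P b) (P c)
  else if (b =? c)%nat then diverging (P b) (P a) (P d)
  else if (b =? d)%nat then diverging (P b) (P a) (P c)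
  else apart (P a) (P b) (P c) (P d).

Definition directed_edges : list (nat * nat) := edges ++ map (fun e => (snd e, fst e)) edges.

Lemma adjb_directed_edge u v : adjb u v = true -> In (u, v) directed_edges.
Proof.
  intros H; apply in_or_app; apply adjb_edge in H as [H | H]; [now left | right].
  apply in_map_iff; now exists (v, u).
Qed.

Lemma placement_distinct : forallb (fun u => forallb (fun v =>
  (u =? v)%nat || distinct (placement u) (placement v)) (seq 0 26)) (seq 0 26) = true.
Proof. vm_compute; reflexivity. Qed.

Lemma placement_off_edges : forallb (fun e => forallb (fun w =>
  (w =? fst e)%nat || (w =? snd e)%nat
  || off_segment (placement (fst e)) (placement (snd e)) (placement w)) (seq 0 26))
  directed_edges = true.
Proof. vm_compute; reflexivity. Qed.

Lemma placement_meet : forallb (fun e => forallb (fun f =>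
  meet_ok (fst e) (snd e) (fst f) (snd f)) directed_edges) directed_edges = true.
Proof. vm_compute; reflexivity. Qed.

Lemma forallb2 {A B} (f : A -> B -> bool) l m :
  forallb (fun x => forallb (f x) m) l = true ->
  forall x y, In x l -> In y m -> f x y = true.
Proof.
  intros H x y Hx Hy; rewrite forallb_forall in H; specialize (H x Hx).
  rewrite forallb_forall in H; auto.
Qed.

Lemma pentagon_drawing : drawing pentagon_graph pentagon_placement.
Proof.
  unfold pentagon_placement; split; [|split].
  - simpl; intros u v Hu Hv E.
    assert (H := forallb2 _ _ _ placement_distinct u v ltac:(apply in_seq; lia)
                   ltac:(apply in_seq; lia)).
    apply Bool.orb_prop in H as [H | H]; [now apply Nat.eqb_eq|].
    now apply distinctP in H.
  - simpl; intros u v w Huv Hw Hwu Hwv; apply adjb_directed_edge in Huv.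
    assert (H := forallb2 _ _ _ placement_off_edges (u, v) w Huv ltac:(apply in_seq; lia)).
    cbn [fst snd] in H.
    apply Nat.eqb_neq in Hwu, Hwv; rewrite Hwu, Hwv in H.
    now apply off_segmentP.
  - simpl; intros a b c d X Hab Hcd Hne HX HX'.
    apply adjb_directed_edge in Hab, Hcd.
    assert (H := forallb2 _ _ _ placement_meet (a, b) (c, d) Hab Hcd); cbn [fst snd] in H.
    unfold meet_ok in H.
    assert (Y := on_seg_sym _ _ _ HX); assert (Y' := on_seg_sym _ _ _ HX').
    destruct (Nat.eqb_spec a c) as [-> | _].
    { destruct (Nat.eqb_spec b d) as [-> | _]; [tauto|].
      assert (E : X = realize (placement c)) by (eapply divergingP; eassumption); auto. }
    destruct (Nat.eqb_spec a d) as [-> | _].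
    { destruct (Nat.eqb_spec b c) as [-> | _]; [tauto|].
      assert (E : X = realize (placement d)) by (eapply divergingP; eassumption); auto. }
    destruct (Nat.eqb_spec b c) as [-> | _].
    { assert (E : X = realize (placement c)) by (eapply divergingP; eassumption); auto. }
    destruct (Nat.eqb_spec b d) as [-> | _].
    { assert (E : X = realize (placement d)) by (eapply divergingP; eassumption); auto. }
    exfalso; eapply apartP; eassumption.
Qed.

Definition line_through (P Q : point) : line :=
  (snd P - snd Q, fst Q - fst P, fst Q * snd P - fst P * snd Q).

Lemma line_through_is_line P Q : P <> Q -> is_line (line_through P Q).
Proof.
  destruct P as [p1 p2], Q as [q1 q2]; simpl; intros H [H1 H2]; apply H; f_equal; lra.
Qed.

Lemma on_line_through P Q X : on_line (line_through P Q) X <-> orient P Q X = 0.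
Proof. unfold orient; simpl; split; intros H; lra. Qed.

Lemma on_line_seg l P Q X : on_line l P -> on_line l Q -> on_seg P Q X -> on_line l X.
Proof.
  destruct l as [[a b] c]; simpl; intros HP HQ [t [_ [-> ->]]].
  transitivity ((1 - t) * (a * fst P + b * snd P) + t * (a * fst Q + b * snd Q)); [ring|].
  rewrite HP, HQ; ring.
Qed.

Definition pentagon_line_ends : list (nat * nat) :=
  flat_map (fun i => [(0, 1 + i); (1 + (i + 2) mod 5, 1 + (i + 3) mod 5)]%nat) (seq 0 5).

Definition pentagon_line (e : nat * nat) : line :=
  line_through (pentagon_placement (fst e)) (pentagon_placement (snd e)).

Definition pentagon_lines : list line := map pentagon_line pentagon_line_ends.

Definition on_ends (v : nat) (e : nat * nat) : bool :=
  is_zero (zorient (placement (fst e)) (placement (snd e)) (placement v)).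

Lemma on_endsP v e : on_ends v e = true ->
  on_line (pentagon_line e) (pentagon_placement v).
Proof.
  intros H; apply is_zeroP in H; rewrite value_orient in H; now apply on_line_through.
Qed.

(** The leaves stay on the sides because each is the reflection in its tip of a pentagon vertex
    adjacent to that tip. *)
Lemma pentagon_lines_cover : covered_by pentagon_graph pentagon_placement pentagon_lines.
Proof.
  assert (Hlines : forallb (fun e => (fst e <? 26) && (snd e <? 26) &&
    negb (fst e =? snd e))%nat pentagon_line_ends = true) by (vm_compute; reflexivity).
  assert (Hvertices : forallb (fun v => existsb (on_ends v) pentagon_line_ends) (seq 0 26)
    = true) by (vm_compute; reflexivity).
  assert (Hedges : forallb (fun e => existsb (fun l => on_ends (fst e) l && on_ends (snd e) l)
    pentagon_line_ends) directed_edges = true) by (vm_compute; reflexivity).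
  rewrite forallb_forall in Hlines, Hvertices, Hedges.
  split; [|split].
  - apply Forall_forall; intros l Hl; apply in_map_iff in Hl as [e [<- He]].
    apply Hlines in He; rewrite !Bool.andb_true_iff, !Nat.ltb_lt in He.
    destruct He as [[H1 H2] H3]; apply line_through_is_line.
    apply (vertices_distinct _ _ pentagon_drawing); auto.
    intros E; rewrite E, Nat.eqb_refl in H3; discriminate.
  - intros v Hv; change (v < 26)%nat in Hv.
    assert (Hon := Hvertices v ltac:(apply in_seq; lia)); apply existsb_exists in Hon.
    destruct Hon as [e [He H]]; exists (pentagon_line e).
    split; [exact (in_map _ _ _ He) | now apply on_endsP].
  - intros u v X Huv HX; apply adjb_directed_edge in Huv.
    assert (H := Hedges _ Huv); apply existsb_exists in H as [e [He H]].
    apply andb_prop in H as [H1 H2]; exists (pentagon_line e).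
    split; [exact (in_map _ _ _ He)|].
    eapply on_line_seg; [apply on_endsP, H1 | apply on_endsP, H2 | exact HX].
Qed.

Theorem theorem4p1 :
  exists G : graph, planar G /\
    exists k : nat, rho12 G k /\
      forall p : nat -> point, drawable_on_lines G p k ->
        exists v, (v < nv G)%nat /\
          (~ rational (fst (p v)) \/ ~ rational (snd (p v))).
Proof.
  exists pentagon_graph; split; [exists pentagon_placement; exact pentagon_drawing|].
  exists 10%nat; split; [split|].
  - exists pentagon_placement; split; [exact pentagon_drawing|].
    exists pentagon_lines; split; [reflexivity | exact pentagon_lines_cover].
  - intros p m [Hp (L & <- & HL)].
    destruct (remove_repeated_lines L) as (L' & Hlen & Hincl & Hsame & Hdist).
    assert (HL' := covered_by_subset _ _ _ _ HL Hincl Hsame).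
    assert (H := drawing_lines_ge p L' Hp HL' Hdist); lia.
  - intros p [Hp (L & H10 & HL)].
    destruct (remove_repeated_lines L) as (L' & Hlen & Hincl & Hsame & Hdist).
    assert (HL' := covered_by_subset _ _ _ _ HL Hincl Hsame).
    assert (H := drawing_lines_ge p L' Hp HL' Hdist).
    apply NNPP; intros Hno.
    (* Removing repetitions cannot go below ten lines, so [L'] still has exactly ten. *)
    apply (drawing_irrational p L' Hp HL' Hdist); [lia|].
    intros v Hv; split; apply NNPP; intros Hr; apply Hno; exists v; split; auto.
Qed.
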